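(* Let $0<r_1<r_2$, let $\Omega\subset\mathbb{R}^3$ be the spherical shell $r_1<r<r_2$, with $\Gamma_1,\Gamma_2$, the states $u,u_\alpha$, the cost functionals $J_i,J_{i\alpha}$ ($i=1,\dots,4$) and the constants $G_i,G_{i\alpha}$ ($i=1,\dots,6$) as defined in the context. Let $z_d\in\mathbb{R}$, $M_1,\dots,M_5>0$ and $\alpha>0$; the data among $g,q,b\in\mathbb{R}$ that are not controls are fixed. i) (Control $g$; $q,b$ fixed.) The minimizer of $J_1$ over $\mathbb{R}$ and the optimal value are $$g_{op}=-\frac{G_{4}q\frac{r_2^2}{r_1}+G_5 (b-z_d)}{2r_1^2\left( G_1+ G_3 \frac{M_1}{r_1^4}\right)},$$ $$J_1(g_{op})=\frac{\pi r_1^3}{2\left( G_1 +G_3\frac{M_1}{r_1^4}\right)} \Big[ 4 \left( G_1+G_3\tfrac{M_1}{r_1^4}\right)\left(G_2 q^2 \tfrac{r_2^4}{r_1^2}+G_3(b-z_d)^2+G_6 q \tfrac{r_2^2}{r_1} (b-z_d) \right)-\left( G_4 q\tfrac{r_2^2}{r_1}+G_5(b-z_d)\right)^2\Big].$$ The minimizer $g_{\alpha_{op}}$ of $J_{1\alpha}$ and the value $J_{1\alpha}(g_{\alpha_{op}})$ are given by the same expressions with every $G_i$ replaced by $G_{i\alpha}$. ii) (Control $q$; $g,b$ fixed.) The minimizer of $J_2$ over $\mathbb{R}$ and the optimal value are $$q_{op}=-\frac{r_1}{2r_2^2}\,\frac{G_4 g r_1^2+G_6(b-z_d)}{G_2+\frac{M_2}{r_1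 r_2^2}},$$ $$J_2(q_{op})=\frac{\pi r_1^3}{2\left( G_2+\frac{M_2}{r_1 r_2^2}\right)} \Big[4 \left( G_2+\tfrac{M_2}{r_1 r_2^2}\right) \left(G_1 g^2 r_1^4+ G_3(b-z_d)^2+G_5 g r_1^2 (b-z_d) \right)-\left(G_4 g r_1^2+G_6 (b-z_d) \right)^2 \Big].$$ The minimizer $q_{\alpha_{op}}$ of $J_{2\alpha}$ and the value $J_{2\alpha}(q_{\alpha_{op}})$ are given by the same expressions with every $G_i$ replaced by $G_{i\alpha}$. iii) (Control $b$; $g,q$ fixed.) The minimizer of $J_3$ over $\mathbb{R}$ and the optimal value are $$b_{op}=-\frac{ G_5 g r_1^2 +G_6 q \frac{r_2^2}{r_1} -2 G_3 z_d}{2\left( G_3+\frac{M_3}{r_1}\right)},$$ $$J_3(b_{op})=\frac{\pi r_1^3}{2\left( G_3 +\frac{M_3}{r_1}\right)} \Big[ 4 \left(G_3+\tfrac{M_3}{r_1}\right) \left( G_1 g^2 r_1^4 +G_2 q^2 \tfrac{r_2^4}{r_1^2}+G_3 z_d^2+G_4 g q r_1 r_2^2 -G_5 g r_1^2 z_d +G_6 q \tfrac{r_2^2}{r_1 }z_d\right)-\left( -2 G_3 z_d +G_5 g r_1^2 +G_6 q \tfrac{r_2^2}{r_1}\right)^2 \Big].$$ The minimizer $b_{\alpha_{op}}$ of $J_{3\alpha}$ and the value $J_{3\alpha}(b_{\alpha_{op}})$ are given by the same expressions with every $G_i$ replaced by $G_{i\alpha}$. iv) (Control $(g,q)$; $b$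 fixed.) The minimizer of $J_4$ over $\mathbb{R}\times\mathbb{R}$ is $$(g,q)_{op}=(g^{op},q^{op})=\left( \frac{b-z_d}{r_1^2} \Delta_3,\ \frac{(b-z_d)r_1}{r_2^2} \Pi_3\right),$$ $$\Delta_3=\frac{G_4 G_6-2 G_5 \left( G_2 +\frac{M_5}{r_1 r_2^2}\right)}{4 \left( G_1 +G_3 \frac{M_4}{r_1^4}\right) \left( G_2 +\frac{M_5}{r_1 r_2^2}\right)-G_4^2}, \qquad \Pi_3=\frac{G_4 G_5-2 G_6 \left( G_1+G_3 \frac{M_4}{r_1^4}\right)}{4\left(G_1+G_3 \frac{M_4}{r_1^4} \right)\left( G_2+\frac{M_5}{r_1 r_2^2}\right) -G_4^2},$$ and $$J_4(g^{op},q^{op})=\frac{2\pi (b-z_d)^2 r_1^3}{4 \left(G_1+G_3\frac{M_4}{r_1^4} \right)\left( G_2+\frac{M_5}{r_1 r_2^2}\right)-G_4^2} \Big[ G_4 G_5 G_6+4\left( G_1+G_3 \tfrac{M_4}{r_1^4}\right)\left( G_2+\tfrac{M_5}{r_1 r_2^2}\right)G_3-\left(G_1+G_3 \tfrac{M_4}{r_1^4} \right) G_6^2-\left( G_2+\tfrac{M_5}{r_1 r_2^2}\right)G_5^2-G_3 G_4^2\Big].$$ The minimizer $(g,q)_{\alpha_{op}}=(g_\alpha^{op},q_\alpha^{op})$ of $J_{4\alpha}$ and the value $J_{4\alpha}(g_\alpha^{op},q_\alpha^{op})$ are given by the same expressions with every $G_i$ replaced by $G_{i\alpha}$. v) As $\alpha\to\infty$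 (all other data fixed): $g_{\alpha_{op}}\to g_{op}$, $q_{\alpha_{op}}\to q_{op}$, $b_{\alpha_{op}}\to b_{op}$, $(g_\alpha^{op},q_\alpha^{op})\to(g^{op},q^{op})$, and $|g_{\alpha_{op}}-g_{op}|$, $|q_{\alpha_{op}}-q_{op}|$, $|b_{\alpha_{op}}-b_{op}|$, $|g_\alpha^{op}-g^{op}|$, $|q_\alpha^{op}-q^{op}|$ are all $\mathcal{O}(1/\alpha)$. Moreover $J_{1\alpha}(g_{\alpha_{op}})\to J_1(g_{op})$, $J_{2\alpha}(q_{\alpha_{op}})\to J_2(q_{op})$, $J_{3\alpha}(b_{\alpha_{op}})\to J_3(b_{op})$, $J_{4\alpha}((g,q)_{\alpha_{op}})\to J_4((g,q)_{op})$, and in each of the four cases the absolute value of the difference is $\mathcal{O}(1/\alpha)$.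
   Context: Domain (spherical coordinates, $r$ the distance to the origin): $\Omega=\{r_1<r<r_2\}\subset\mathbb{R}^3$, $\Gamma_1=\{r=r_1\}$, $\Gamma_2=\{r=r_2\}$. $\partial/\partial n$ is the outward normal derivative. States: for real constants $g,q,b$ and $\alpha>0$, $u$ is the unique solution of $$-\Delta u=g\ \text{in }\Omega,\quad u|_{\Gamma_1}=b,\quad -\tfrac{\partial u}{\partial n}|_{\Gamma_2}=q,$$ and $u_\alpha$ is the unique solution of $$-\Delta u_\alpha=g\ \text{in }\Omega,\quad -\tfrac{\partial u_\alpha}{\partial n}|_{\Gamma_1}=\alpha(u_\alpha-b),\quad -\tfrac{\partial u_\alpha}{\partial n}|_{\Gamma_2}=q.$$ Cost functionals, with $H=L^2(\Omega)$, $Q=L^2(\Gamma_2)$, $B=L^2(\Gamma_1)$ and real numbers identified with constant functions: $J_1(g)=\frac12\|u-z_d\|_H^2+\frac{M_1}{2}\|g\|_H^2$ (as a function of $g\in\mathbb{R}$, with $q,b$ fixed); $J_2(q)=\frac12\|u-z_d\|_H^2+\frac{M_2}{2}\|q\|_Q^2$ (function of $q\in\mathbb{R}$, $g,b$ fixed); $J_3(b)=\frac12\|u-z_d\|_H^2+\frac{M_3}{2}\|b\|_B^2$ (function of $b\in\mathbb{R}$, $g,q$ fixed); $J_4(g,q)=\frac12\|u-z_d\|_H^2+\frac{M_4}{2}\|g\|_H^2+\frac{M_5}{2}\|q\|_Q^2$ (function of $(g,q)\in\mathbb{R}^2$, $b$ fixed). $J_{1\alpha},\dots,J_{4\alpha}$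 are defined in the same way with $u$ replaced by $u_\alpha$. Constants. Write $\rho=r_2/r_1$, $\varepsilon=\frac{1}{\alpha r_1}$. $G_1=-\frac{2}{945}+\frac1{45}\rho^3-\frac1{15}\rho^5+\frac17\rho^7-\frac2{15}\rho^8+\frac1{27}\rho^9$, $G_2=-\frac13+\rho-\rho^2+\frac13\rho^3$, $G_3=\frac13(-1+\rho^3)$, $G_4=-\frac7{180}+\frac16\rho^2+\frac19\rho^3-\frac34\rho^4+\frac{11}{15}\rho^5-\frac29\rho^6$, $G_5=-\frac2{45}+\frac29\rho^3-\frac25\rho^5+\frac29\rho^6$, $G_6=-\frac13+\rho^2-\frac23\rho^3$; $G_{1\alpha}=-\frac2{945}+\frac{2}{135}\varepsilon-\frac1{27}\varepsilon^2+\rho^3(\frac1{45}-\frac4{45}\varepsilon+\frac19\varepsilon^2)-\frac1{15}\rho^5(1-2\varepsilon)-\frac19\varepsilon^2\rho^6+\frac17\rho^7-\frac2{15}\rho^8(1+\varepsilon)+\frac1{27}\rho^9(1+2\varepsilon+\varepsilon^2)$, $G_{2\alpha}=-\frac13(1-\varepsilon+\varepsilon^2)+\rho-\rho^2(1+\varepsilon)+\frac13\rho^3(1+2\varepsilon+\varepsilon^2)$, $G_{3\alpha}=G_3$, $G_{4\alpha}=-\frac7{180}+\frac7{45}\varepsilon-\frac29\varepsilon^2+\frac16\rho^2(1-2\varepsilon)+\frac19\rho^3(1-\varepsilon+4\varepsilon^2)-\frac34\rho^4+\frac{11}{15}\rho^5(1+\varepsilon)-\frac29\rho^6(1+2\varepsilon+\varepsilon^2)$,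 $G_{5\alpha}=-\frac2{45}+\frac29\varepsilon+\frac29\rho^3(1-2\varepsilon)-\frac25\rho^5+\frac29\rho^6(1+\varepsilon)$, $G_{6\alpha}=-\frac13(1-2\varepsilon)+\rho^2-\frac23\rho^3(1+\varepsilon)$.
   Formalization: In iii), the term $+G_6 q\frac{r_2^2}{r_1}z_d$ in the optimal value of $J_3$ (and its analogue for $J_{3\alpha}$) is a sign error, false when $q z_d\neq 0$ in the Dirichlet case; the formal statement has $-G_6 q\frac{r_2^2}{r_1}z_d$. *)

(* Defs.v *)
From HB Require Import structures.
From mathcomp Require Import all_boot all_order all_algebra.
From mathcomp Require Import all_classical all_reals all_analysis.
From mathcomp Require Import measurable_realfun.

Set Implicit Arguments.
Unset Strict Implicit.
Unset Printing Implicit Defensive.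

Import Order.TTheory GRing.Theory Num.Theory.
Import numFieldNormedType.Exports.

Local Open Scope classical_set_scope.
Local Open Scope ring_scope.

(* The library's norm on R * R * R is the sup norm; only the topology it
   induces is used, and distances to the origin go through [radius]. *)
Notation pt R := (R * R * R)%type.

Definition radius (R : realType) (x : pt R) : R :=
  Num.sqrt (x.1.1 ^+ 2 + x.1.2 ^+ 2 + x.2 ^+ 2).

Definition shell (R : realType) (r1 r2 : R) : set (pt R) :=
  [set x | r1 < radius x < r2].

Definition closed_shell (R : realType) (r1 r2 : R) : set (pt R) :=
  [set x | r1 <= radius x <= r2].

Definition sphere (R : realType) (r : R) : set (pt R) := [set x | radius x = r].

Definition axis (R : realType) (i : 'I_3) : pt R :=
  ((i == 0 :> nat)%:R, (i == 1%N :> nat)%:R, (i == 2%N :> nat)%:R).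

Definition laplacian (R : realType) (u : pt R -> R) (x : pt R) : R :=
  \sum_(i < 3) 'D_(axis R i) ('D_(axis R i) u) x.

Definition C2_on (R : realType) (A : set (pt R)) (u : pt R -> R) : Prop :=
  forall x, A x -> forall i j : 'I_3,
    [/\ derivable u x (axis R i),
        {for x, continuous ('D_(axis R i) u)},
        derivable ('D_(axis R i) u) x (axis R j) &
        {for x, continuous ('D_(axis R j) ('D_(axis R i) u))}].

(* [d] is the derivative of [u] at [x] in the direction [n]; the difference
   quotient uses only the points [x - t n], which lie in the domain when [n] is
   an outward normal at the boundary point [x]. *)
Definition is_normal_derivative (R : realType) (u : pt R -> R) (x n : pt R)
    (d : R) : Prop :=
  (u x - u (x - t *: n)) / t @[t --> 0^'+] --> d.

Definition outward_normal1 (R : realType) (r1 : R) (x : pt R) : pt R :=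
  - (r1^-1 *: x).

Definition outward_normal2 (R : realType) (r2 : R) (x : pt R) : pt R :=
  r2^-1 *: x.

Definition poisson_eq (R : realType) (r1 r2 g : R) (u : pt R -> R) : Prop :=
  [/\ C2_on (shell r1 r2) u,
      {within closed_shell r1 r2, continuous u} &
      forall x, shell r1 r2 x -> - laplacian u x = g].

Definition solves_dirichlet (R : realType) (r1 r2 g q b : R)
    (u : pt R -> R) : Prop :=
  [/\ poisson_eq r1 r2 g u,
      forall x, sphere r1 x -> u x = b &
      forall x, sphere r2 x ->
        is_normal_derivative u x (outward_normal2 r2 x) (- q)].

Definition solves_robin (R : realType) (r1 r2 alpha g q b : R)
    (u : pt R -> R) : Prop :=
  [/\ poisson_eq r1 r2 g u,
      forall x, sphere r1 x ->
        is_normal_derivative u x (outward_normal1 r1 x)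
          (- (alpha * (u x - b))) &
      forall x, sphere r2 x ->
        is_normal_derivative u x (outward_normal2 r2 x) (- q)].

(* Definite description, uniqueness being understood for the values on [A]:
   solutions are total functions, unconstrained off [A]. The value is the zero
   function if [P] has no solution or has two that differ somewhere on [A]. *)
Definition unique_solution (R : realType) (A : set (pt R))
    (P : (pt R -> R) -> Prop) : pt R -> R :=
  xget (fun=> 0) [set u | P u /\ forall v, P v -> forall x, A x -> v x = u x].

Definition state (R : realType) (r1 r2 g q b : R) : pt R -> R :=
  unique_solution (closed_shell r1 r2) (solves_dirichlet r1 r2 g q b).

Definition robin_state (R : realType) (r1 r2 alpha g q b : R) : pt R -> R :=
  unique_solution (closed_shell r1 r2) (solves_robin r1 r2 alpha g q b).

Definition volume (R : realType) :
    set (measurableTypeR R * measurableTypeR R * measurableTypeR R) -> \bar R :=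
  ((lebesgue_measure \x lebesgue_measure) \x lebesgue_measure)%E.

Definition sqnorm_shell (R : realType) (r1 r2 : R) (f : pt R -> R) : R :=
  \int[@volume R]_(x in shell r1 r2) (f x ^+ 2).

(* Surface integral over the sphere of radius [r]; theta is the colatitude and
   r^2 sin theta the surface element. *)
Definition sphere_integral (R : realType) (r : R) (f : pt R -> R) : R :=
  \int[lebesgue_measure]_(phi in `[0, 2 * pi])
    \int[lebesgue_measure]_(theta in `[0, pi])
      (f (r * sin theta * cos phi, r * sin theta * sin phi, r * cos theta)
       * (r ^+ 2 * sin theta)).

Definition sqnorm_sphere (R : realType) (r : R) (f : pt R -> R) : R :=
  sphere_integral r (fun x => f x ^+ 2).

(* [S g q b] is the state associated with the data [g], [q], [b]. *)

Definition J1 (R : realType) (r1 r2 : R) (S : R -> R -> R -> pt R -> R)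
    (zd M q b : R) (g : R) : R :=
  1 / 2 * sqnorm_shell r1 r2 (fun x => S g q b x - zd)
  + M / 2 * sqnorm_shell r1 r2 (fun=> g).

Definition J2 (R : realType) (r1 r2 : R) (S : R -> R -> R -> pt R -> R)
    (zd M g b : R) (q : R) : R :=
  1 / 2 * sqnorm_shell r1 r2 (fun x => S g q b x - zd)
  + M / 2 * sqnorm_sphere r2 (fun=> q).

Definition J3 (R : realType) (r1 r2 : R) (S : R -> R -> R -> pt R -> R)
    (zd M g q : R) (b : R) : R :=
  1 / 2 * sqnorm_shell r1 r2 (fun x => S g q b x - zd)
  + M / 2 * sqnorm_sphere r1 (fun=> b).

Definition J4 (R : realType) (r1 r2 : R) (S : R -> R -> R -> pt R -> R)
    (zd M4 M5 b : R) (gq : R * R) : R :=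
  1 / 2 * sqnorm_shell r1 r2 (fun x => S gq.1 gq.2 b x - zd)
  + M4 / 2 * sqnorm_shell r1 r2 (fun=> gq.1)
  + M5 / 2 * sqnorm_sphere r2 (fun=> gq.2).

Definition is_the_minimizer (R : realType) (T : Type) (J : T -> R) (c : T) :
    Prop :=
  (forall c', J c <= J c') /\
  (forall c', (forall c'', J c' <= J c'') -> c' = c).

Definition is_bigO_inv (R : realType) (f : R -> R) : Prop :=
  exists2 C, 0 < C & \forall alpha \near +oo, `|f alpha| <= C * (1 / alpha).

Record coefs (R : Type) := Coefs
  { G1 : R; G2 : R; G3 : R; G4 : R; G5 : R; G6 : R }.

Definition Gdirichlet (R : realType) (r1 r2 : R) : coefs R :=
  let rho := r2 / r1 in
  {| G1 := - (2 / 945) + 1 / 45 * rho ^+ 3 - 1 / 15 * rho ^+ 5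
           + 1 / 7 * rho ^+ 7 - 2 / 15 * rho ^+ 8 + 1 / 27 * rho ^+ 9;
     G2 := - (1 / 3) + rho - rho ^+ 2 + 1 / 3 * rho ^+ 3;
     G3 := 1 / 3 * (- 1 + rho ^+ 3);
     G4 := - (7 / 180) + 1 / 6 * rho ^+ 2 + 1 / 9 * rho ^+ 3
           - 3 / 4 * rho ^+ 4 + 11 / 15 * rho ^+ 5 - 2 / 9 * rho ^+ 6;
     G5 := - (2 / 45) + 2 / 9 * rho ^+ 3 - 2 / 5 * rho ^+ 5
           + 2 / 9 * rho ^+ 6;
     G6 := - (1 / 3) + rho ^+ 2 - 2 / 3 * rho ^+ 3 |}.

Definition Grobin (R : realType) (r1 r2 alpha : R) : coefs R :=
  let rho := r2 / r1 in
  let eps := 1 / (alpha * r1) in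
  {| G1 := - (2 / 945) + 2 / 135 * eps - 1 / 27 * eps ^+ 2
           + rho ^+ 3 * (1 / 45 - 4 / 45 * eps + 1 / 9 * eps ^+ 2)
           - 1 / 15 * rho ^+ 5 * (1 - 2 * eps)
           - 1 / 9 * eps ^+ 2 * rho ^+ 6
           + 1 / 7 * rho ^+ 7
           - 2 / 15 * rho ^+ 8 * (1 + eps)
           + 1 / 27 * rho ^+ 9 * (1 + 2 * eps + eps ^+ 2);
     G2 := - (1 / 3) * (1 - eps + eps ^+ 2) + rho - rho ^+ 2 * (1 + eps)
           + 1 / 3 * rho ^+ 3 * (1 + 2 * eps + eps ^+ 2);
     G3 := 1 / 3 * (- 1 + rho ^+ 3);
     G4 := - (7 / 180) + 7 / 45 * eps - 2 / 9 * eps ^+ 2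
           + 1 / 6 * rho ^+ 2 * (1 - 2 * eps)
           + 1 / 9 * rho ^+ 3 * (1 - eps + 4 * eps ^+ 2)
           - 3 / 4 * rho ^+ 4
           + 11 / 15 * rho ^+ 5 * (1 + eps)
           - 2 / 9 * rho ^+ 6 * (1 + 2 * eps + eps ^+ 2);
     G5 := - (2 / 45) + 2 / 9 * eps + 2 / 9 * rho ^+ 3 * (1 - 2 * eps)
           - 2 / 5 * rho ^+ 5 + 2 / 9 * rho ^+ 6 * (1 + eps);
     G6 := - (1 / 3) * (1 - 2 * eps) + rho ^+ 2
           - 2 / 3 * rho ^+ 3 * (1 + eps) |}.

Definition g_opt (R : realType) (r1 r2 : R) (G : coefs R) (zd M q b : R) : R :=
  - ((G4 G * q * (r2 ^+ 2 / r1) + G5 G * (b - zd))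
     / (2 * r1 ^+ 2 * (G1 G + G3 G * (M / r1 ^+ 4)))).

Definition J1_opt (R : realType) (r1 r2 : R) (G : coefs R) (zd M q b : R) : R :=
  let A := G1 G + G3 G * (M / r1 ^+ 4) in
  pi * r1 ^+ 3 / (2 * A)
  * (4 * A * (G2 G * q ^+ 2 * (r2 ^+ 4 / r1 ^+ 2) + G3 G * (b - zd) ^+ 2
              + G6 G * q * (r2 ^+ 2 / r1) * (b - zd))
     - (G4 G * q * (r2 ^+ 2 / r1) + G5 G * (b - zd)) ^+ 2).

Definition q_opt (R : realType) (r1 r2 : R) (G : coefs R) (zd M g b : R) : R :=
  - (r1 / (2 * r2 ^+ 2))
  * ((G4 G * g * r1 ^+ 2 + G6 G * (b - zd)) / (G2 G + M / (r1 * r2 ^+ 2))).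

Definition J2_opt (R : realType) (r1 r2 : R) (G : coefs R) (zd M g b : R) : R :=
  let A := G2 G + M / (r1 * r2 ^+ 2) in
  pi * r1 ^+ 3 / (2 * A)
  * (4 * A * (G1 G * g ^+ 2 * r1 ^+ 4 + G3 G * (b - zd) ^+ 2
              + G5 G * g * r1 ^+ 2 * (b - zd))
     - (G4 G * g * r1 ^+ 2 + G6 G * (b - zd)) ^+ 2).

Definition b_opt (R : realType) (r1 r2 : R) (G : coefs R) (zd M g q : R) : R :=
  - ((G5 G * g * r1 ^+ 2 + G6 G * q * (r2 ^+ 2 / r1) - 2 * G3 G * zd)
     / (2 * (G3 G + M / r1))).

(* The cross term [q zd] carries a minus sign, as does [g zd]: the b-free part
   of the cost is the full quadratic form with [b - zd] replaced by [- zd]. *)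
Definition J3_opt (R : realType) (r1 r2 : R) (G : coefs R) (zd M g q : R) : R :=
  let A := G3 G + M / r1 in
  pi * r1 ^+ 3 / (2 * A)
  * (4 * A * (G1 G * g ^+ 2 * r1 ^+ 4 + G2 G * q ^+ 2 * (r2 ^+ 4 / r1 ^+ 2)
              + G3 G * zd ^+ 2 + G4 G * g * q * r1 * r2 ^+ 2
              - G5 G * g * r1 ^+ 2 * zd - G6 G * q * (r2 ^+ 2 / r1) * zd)
     - (- 2 * G3 G * zd + G5 G * g * r1 ^+ 2 + G6 G * q * (r2 ^+ 2 / r1)) ^+ 2).

Definition gq_opt (R : realType) (r1 r2 : R) (G : coefs R) (zd M4 M5 b : R) :
    R * R :=
  let A := G1 G + G3 G * (M4 / r1 ^+ 4) in
  let C := G2 G + M5 / (r1 * r2 ^+ 2) in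
  let Delta3 := (G4 G * G6 G - 2 * G5 G * C) / (4 * A * C - G4 G ^+ 2) in
  let Pi3 := (G4 G * G5 G - 2 * G6 G * A) / (4 * A * C - G4 G ^+ 2) in
  ((b - zd) / r1 ^+ 2 * Delta3, (b - zd) * r1 / r2 ^+ 2 * Pi3).

Definition J4_opt (R : realType) (r1 r2 : R) (G : coefs R) (zd M4 M5 b : R) :
    R :=
  let A := G1 G + G3 G * (M4 / r1 ^+ 4) in
  let C := G2 G + M5 / (r1 * r2 ^+ 2) in
  2 * pi * (b - zd) ^+ 2 * r1 ^+ 3 / (4 * A * C - G4 G ^+ 2)
  * (G4 G * G5 G * G6 G + 4 * A * C * G3 G - A * G6 G ^+ 2 - C * G5 G ^+ 2
     - G3 G * G4 G ^+ 2).

(* Main.v *)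
Require Import Defs.
From HB Require Import structures.
From mathcomp Require Import all_boot all_order all_algebra.
From mathcomp Require Import all_classical all_reals all_analysis.
From mathcomp Require Import measurable_realfun.
From mathcomp Require Import ring lra.

Import Order.TTheory GRing.Theory Num.Theory.
Import numFieldNormedType.Exports.
Import Defs.

Local Open Scope classical_set_scope.
Local Open Scope ring_scope.

Set Implicit Arguments.
Unset Strict Implicit.
Unset Printing Implicit Defensive.

(** Both boundary conditions on the inner sphere read u + k du/dn = b: the case
    k = 0 is the Dirichlet condition and k = 1 / alpha the Robin condition, so
    one computation with a parameter k >= 0 covers the two families of problems.

    The states are radial. A function A + B r^2 + C / r of the distance r to the
    origin has the constant Laplacian 6 B outside the origin, and A, B, C can be
    fitted to the source, to the outer flux and to the inner condition
    ([solves_mixed_profile]). It is the only solution by a maximum principle.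
    The difference w of two solutions is harmonic and has the normal derivative 0
    on the outer sphere. Adding a small multiple e of a radial function with
    positive Laplacian and with a negative normal derivative on the outer sphere
    excludes a maximum inside the shell and on the outer sphere; at a maximum on
    the inner sphere the boundary condition bounds w by a multiple of e
    ([barrier_max], [shell_le0]), and e is arbitrary. This suits classical
    solutions, whose derivatives may be unbounded near the boundary: it uses
    them only near a maximum point.

    The integral of h(r) over the shell is that of 4 pi r^2 h(r) over the
    interval. The volume of a ball is computed by slicing ([volume_ball]);
    the integral over r <= t is then squeezed between multiples of volumes, hence
    differentiable in t with derivative 4 pi t^2 h(t) ([Rintegral_shell]).
    For h = (u - zd)^2 the function r^2 h(r) is a polynomial, and the squared
    distance comes out as 4 pi r1^3 times a quadratic form in g r1^2, q r2^2 / r1 and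
    b - zd, whose coefficients are the constants G_i ([Gform_Grobin]).

    Hence every cost is a quadratic polynomial in its controls, minimized by
    completing the square. It is strictly convex because the form is
    nonnegative, being the square of a norm, and the weights M_i are positive
    ([discriminant_gt0]). Finally, the optimal controls and values are rational
    functions of 1 / alpha without pole at 0, which gives the limits and the
    rates ([tends_inv]). *)

(** * Derivatives of radial functions *)

(** Directional derivatives are one-variable derivatives, so that the
    one-variable chain rule applies to them. *)
Lemma is_derive_lineP (R : realType) (V : normedModType R) (F : V -> R)
    (x v : V) (t d : R) :
  is_derive t (1 : R) (fun t : R => F (t *: v + x)) d <->
  is_derive (t *: v + x) v F d.
Proof.
have E : (fun h : R => h^-1 *: ((F \o shift (t *: v + x)) (h *: v) - F (t *: v + x))) =
  (fun h : R => h^-1 *: (((fun t => F (t *: v + x)) \o shift t) (h *: 1) - F (t *: v + x))).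
  by apply/funext => h /=; rewrite addrA [_%:A]mulr1 scalerDl.
split; move=> [dF DF]; apply: DeriveDef.
- by rewrite /derivable E.
- by rewrite -DF /derive E.
- by rewrite /derivable -E.
- by rewrite -DF /derive E.
Qed.

Lemma is_derive_line0 (R : realType) (V : normedModType R) (F : V -> R) (x v : V) (d : R) :
  is_derive (0 : R) (1 : R) (fun t : R => F (t *: v + x)) d -> is_derive x v F d.
Proof. by move/is_derive_lineP; rewrite scale0r add0r. Qed.

Definition coord (R : realType) (i : 'I_3) (x : pt R) : R :=
  nth 0 [:: x.1.1; x.1.2; x.2] i.

Definition dot (R : realType) (x y : pt R) : R :=
  x.1.1 * y.1.1 + x.1.2 * y.1.2 + x.2 * y.2.

Lemma dot_axis (R : realType) (i : 'I_3) (x : pt R) : dot x (axis R i) = coord i x.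
Proof.
rewrite /dot /coord /axis.
by case: i => [[|[|[|]]]] //= _; rewrite ?(mulr0, mulr1, addr0, add0r).
Qed.

Lemma coord_axis (R : realType) (i j : 'I_3) : coord i (axis R j) = (i == j)%:R.
Proof.
case: i => [[|[|[|]]]] // ?; case: j => [[|[|[|]]]] //.
Qed.

Lemma sum_sqr_coord (R : realType) (x : pt R) :
  \sum_(i < 3) coord i x ^+ 2 = radius x ^+ 2.
Proof.
rewrite !big_ord_recr big_ord0 /= add0r /coord /= /radius sqr_sqrtr//.
by rewrite !addr_ge0 ?sqr_ge0.
Qed.

Lemma continuous_coord (R : realType) (i : 'I_3) : continuous (@coord R i : R * R * R -> R).
Proof.
have c1 : continuous (fun x : R * R * R => x.1.1).
  by move=> y; apply: (@continuous_comp _ _ _ fst fst); exact: cvg_fst.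
have c2 : continuous (fun x : R * R * R => x.1.2).
  by move=> y; apply: (@continuous_comp _ _ _ fst snd); [exact: cvg_fst|exact: cvg_snd].
have c3 : continuous (fun x : R * R * R => x.2) by move=> y; exact: cvg_snd.
by case: i => [[|[|[|]]]] //=.
Qed.

Lemma continuous_radius (R : realType) : continuous (@radius R : R * R * R -> R).
Proof.
move=> x.
apply: (@continuous_comp _ _ _ (fun x : R * R * R => x.1.1 ^+ 2 + x.1.2 ^+ 2 + x.2 ^+ 2)
  Num.sqrt); last exact: sqrt_continuous.
have ci := @continuous_coord R.
rewrite (_ : (fun _ => _) = (fun y : R * R * R => y.1.1 * y.1.1 + y.1.2 * y.1.2 + y.2 * y.2));
  last by apply/funext => y; rewrite !expr2.
by apply: cvgD; [apply: cvgD|]; apply: cvgM;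
  [exact: (ci (@Ordinal 3 0 isT))|exact: (ci (@Ordinal 3 0 isT))
  |exact: (ci (@Ordinal 3 1 isT))|exact: (ci (@Ordinal 3 1 isT))
  |exact: (ci (@Ordinal 3 2 isT))|exact: (ci (@Ordinal 3 2 isT))].
Qed.

Lemma is_derive_coord (R : realType) (i : 'I_3) (x v : pt R) :
  is_derive x v (@coord R i : R * R * R -> R) (coord i v).
Proof.
apply: is_derive_line0.
rewrite (_ : (fun _ => _) = (fun t => t * coord i v + coord i x)); last first.
  by apply/funext => t; case: i => [[|[|[|]]]].
by apply: is_derive_eq; rewrite !scaler0 addr0 /= add0r /= [_%:A]mulr1.
Qed.

Lemma is_derive_radius (R : realType) (x v : pt R) : 0 < radius x ->
  is_derive x v (@radius R : R * R * R -> R) (dot x v / radius x).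
Proof.
move=> r0; apply: is_derive_line0.
pose f (t : R) := (t * v.1.1 + x.1.1) ^+ 2 + (t * v.1.2 + x.1.2) ^+ 2 + (t * v.2 + x.2) ^+ 2.
have -> : (fun t => radius (t *: v + x)) = Num.sqrt \o f by [].
have f0 : f 0 = x.1.1 ^+ 2 + x.1.2 ^+ 2 + x.2 ^+ 2 by rewrite /f !mul0r !add0r.
have df : is_derive (0 : R) (1 : R) f (2 * dot x v).
  apply: is_derive_eq; rewrite /dot !scaler0 /= !add0r !addr0 /GRing.scale /=.
  ring.
have fp : 0 < f 0.
  by rewrite f0; move: r0; rewrite /radius sqrtr_gt0.
have ds : is_derive (f 0) 1 Num.sqrt (2 * Num.sqrt (f 0))^-1 by exact: is_derive1_sqrt.
have dc := @is_derive1_comp _ Num.sqrt f 0 _ _ ds df.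
suff -> : dot x v / radius x = (2 * Num.sqrt (f 0))^-1 * (2 * dot x v) by exact: dc.
rewrite /= -[radius x]/(Num.sqrt _) -f0.
have : Num.sqrt (f 0) != 0 by rewrite gt_eqF // sqrtr_gt0.
by move=> ?; field.
Qed.

Lemma is_derive_radial (R : realType) (phi : R -> R) (x v : pt R) (d : R) :
  0 < radius x -> is_derive (radius x) (1 : R) phi d ->
  is_derive x v (fun y : R * R * R => phi (radius y)) (d * (dot x v / radius x)).
Proof.
move=> r0 dphi; apply: is_derive_line0.
apply: (@is_derive1_comp _ phi (fun t : R => radius (t *: v + x))).
  by rewrite scale0r add0r.
by apply/is_derive_lineP; rewrite scale0r add0r; exact: is_derive_radius.
Qed.

Lemma near_radius_gt (R : realType) (x : R * R * R) (r : R) :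
  r < radius x -> \forall y \near x, r < radius y.
Proof. by move=> rx; exact: (cvgr_gt (radius x) (@continuous_radius R x)). Qed.

Lemma near_radius_lt (R : realType) (x : R * R * R) (r : R) :
  radius x < r -> \forall y \near x, radius y < r.
Proof. by move=> rx; exact: (cvgr_lt (radius x) (@continuous_radius R x)). Qed.

(** For a radial function phi(r) it is convenient to write phi' = r psi and
    psi' = r chi: the partial derivatives are then polynomials in the
    coordinates with coefficients psi(r) and chi(r), without division by r. *)
Section radial.
Context (R : realType) (phi psi chi : R -> R).
Hypothesis dphi : forall r : R, 0 < r -> is_derive r (1 : R) phi (r * psi r).
Hypothesis dpsi : forall r : R, 0 < r -> is_derive r (1 : R) psi (r * chi r).
Hypothesis cchi : forall r : R, 0 < r -> {for r, continuous chi}.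

Let u : R * R * R -> R := fun x => phi (radius x).

Lemma derive1_radial (i : 'I_3) (x : R * R * R) : 0 < radius x ->
  is_derive x (axis R i) u (coord i x * psi (radius x)).
Proof.
move=> r0; have := is_derive_radial (axis R i) r0 (dphi r0).
rewrite dot_axis; congr (is_derive _ _ _ _).
by have := lt0r_neq0 r0; move: (radius x) => r rn0; field.
Qed.

Lemma derive2_radial (i j : 'I_3) (x : R * R * R) : 0 < radius x ->
  is_derive x (axis R j) ('D_(axis R i) u)
    (coord i x * coord j x * chi (radius x) + (i == j)%:R * psi (radius x)).
Proof.
move=> r0.
have dp := is_derive_radial (axis R j) r0 (dpsi r0).
have dc := is_derive_coord i x (axis R j).
have [dd de] := is_deriveM dc dp.
apply: (@near_eq_is_derive _ _ _
  ((@coord R i : R * R * R -> R) * (fun y => psi (radius y)))).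
  near=> y; apply/esym; apply: (@derive_val _ _ _ _ _ _ _ (@derive1_radial i y _)).
    by near: y; exact: near_radius_gt.
apply: DeriveDef; first exact: dd.
rewrite de coord_axis dot_axis /GRing.scale /=.
have := lt0r_neq0 r0; move: (radius x) => r rn0.
by field.
Unshelve. all: by end_near. Qed.

Lemma C2_radial (A : set (pt R)) : (forall x, A x -> 0 < radius x) -> C2_on A u.
Proof.
move=> A0 x /A0 r0 i j.
have cr := @continuous_radius R x.
have cpsi : {for x, continuous (fun y : R * R * R => psi (radius y))}.
  apply: continuous_comp => //.
  by apply/differentiable_continuous/derivable1_diffP; case: (dpsi r0).
have cc : {for x, continuous (fun y : R * R * R => chi (radius y))}.
  by apply: continuous_comp => //; exact: cchi.
split.
- by case: (derive1_radial i r0).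
- have E : \near x, coord i x * psi (radius x) = 'D_(axis R i) u x.
    near=> y; apply/esym; apply: (@derive_val _ _ _ _ _ _ _ (@derive1_radial i y _)).
    by near: y; exact: near_radius_gt.
  rewrite /prop_for /continuous_at -(nbhs_singleton E).
  apply: cvg_trans; first exact: (near_eq_cvg E).
  by apply: cvgM => //; exact: continuous_coord.
- by case: (derive2_radial i j r0).
- have E : \near x, coord i x * coord j x * chi (radius x) + (i == j)%:R * psi (radius x)
     = 'D_(axis R j) ('D_(axis R i) u) x.
    near=> y; apply/esym; apply: (@derive_val _ _ _ _ _ _ _ (@derive2_radial i j y _)).
    by near: y; exact: near_radius_gt.
  rewrite /prop_for /continuous_at -(nbhs_singleton E).
  apply: cvg_trans; first exact: (near_eq_cvg E).
  apply: cvgD; apply: cvgM => //; last exact: cvg_cst.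
  by apply: cvgM; exact: continuous_coord.
Unshelve. all: by end_near. Qed.

Lemma laplacian_radial (x : R * R * R) : 0 < radius x ->
  laplacian u x = radius x ^+ 2 * chi (radius x) + 3 * psi (radius x).
Proof.
move=> r0; rewrite /laplacian.
under eq_bigr => i _ do rewrite (@derive_val _ _ _ _ _ _ _ (derive2_radial i i r0))
  eqxx mul1r -expr2.
by rewrite big_split /= -mulr_suml sum_sqr_coord sumr_const card_ord mulr_natl.
Qed.

End radial.

(** * The comparison principle in the shell *)

Lemma open_shell (R : realType) (r1 r2 : R) : open (shell r1 r2 : set (R * R * R)).
Proof.
rewrite openE => x /andP[h1 h2]; near=> y.
by apply/andP; split; near: y; [exact: near_radius_gt|exact: near_radius_lt].
Unshelve. all: by end_near. Qed.

Lemma normr_coord_le_radius (R : realType) (i : 'I_3) (x : pt R) :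
  `|coord i x| <= radius x.
Proof.
rewrite -(@ler_pXn2r _ 2)// ?nnegrE ?sqrtr_ge0// real_normK ?num_real//.
rewrite -sum_sqr_coord (bigD1 i)//= lerDl.
by apply: sumr_ge0 => j _; exact: sqr_ge0.
Qed.

Lemma compact_closed_shell (R : realType) (r1 r2 : R) :
  compact (closed_shell r1 r2 : set (R * R * R)).
Proof.
apply: (@subclosed_compact _ _ (`[- r2, r2] `*` `[- r2, r2] `*` `[- r2, r2])).
- rewrite (_ : closed_shell _ _ = @radius R @^-1` `[r1, r2]).
    by apply: closed_comp; [move=> x _; exact: continuous_radius|exact: interval_closed].
  by apply/seteqP; split => x; rewrite /closed_shell /= in_itv.
- by apply: compact_setX; [apply: compact_setX|]; exact: segment_compact.
- move=> x /andP[_ h].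
  have H i : coord i x \in `[- r2, r2].
    by rewrite in_itv /= -ler_norml (le_trans (normr_coord_le_radius _ _)).
  split; [split|].
  + exact: (H (@Ordinal 3 0 isT)).
  + exact: (H (@Ordinal 3 1 isT)).
  + exact: (H (@Ordinal 3 2 isT)).
Qed.

(** One operation u + c v serves both for the difference of two solutions and for
    the perturbation by a barrier. *)
Section C2_combination.
Context (R : realType) (A : set (pt R)) (u v : R * R * R -> R) (c : R).
Hypotheses (oA : open (A : set (R * R * R))) (Cu : C2_on A u) (Cv : C2_on A v).

Let w : R * R * R -> R := fun x => u x + c * v x.

Lemma derivable_comb (f g : R * R * R -> R) (x e : R * R * R) :
  derivable f x e -> derivable g x e ->
  is_derive x e (fun x => f x + c * g x) ('D_e f x + c * 'D_e g x).
Proof.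
move=> /derivableP df /derivableP dg.
have := is_deriveD df (is_deriveZ c dg).
by [].
Qed.

Lemma near_derive_comb (x : R * R * R) (i : 'I_3) : A x ->
  \near x, 'D_(axis R i) u x + c * 'D_(axis R i) v x = 'D_(axis R i) w x.
Proof.
move=> Ax; have : \forall y \near x, A y by exact: open_nbhs_nbhs.
apply: filterS => y Ay; apply/esym/derive_val/derivable_comb.
- by case: (Cu Ay i i).
- by case: (Cv Ay i i).
Qed.

Lemma derive2_comb (x : R * R * R) (i j : 'I_3) : A x ->
  is_derive x (axis R j) ('D_(axis R i) w)
   ('D_(axis R j) ('D_(axis R i) u) x + c * 'D_(axis R j) ('D_(axis R i) v) x).
Proof.
move=> Ax; apply: near_eq_is_derive; first exact: near_derive_comb.
apply: derivable_comb.
- by case: (Cu Ax i j).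
- by case: (Cv Ax i j).
Qed.

Lemma C2_comb : C2_on A w.
Proof.
move=> x Ax i j; have [u1 u2 u3 u4] := Cu Ax i j; have [v1 v2 v3 v4] := Cv Ax i j.
split.
- by case: (derivable_comb u1 v1).
- have E := near_derive_comb i Ax.
  rewrite /prop_for /continuous_at -(nbhs_singleton E).
  apply: cvg_trans; first exact: (near_eq_cvg E).
  by apply: cvgD; [exact: u2|apply: cvgM; [exact: cvg_cst|exact: v2]].
- by case: (derive2_comb i j Ax).
- have E : \near x, 'D_(axis R j) ('D_(axis R i) u) x + c * 'D_(axis R j) ('D_(axis R i) v) x
     = 'D_(axis R j) ('D_(axis R i) w) x.
    have : \forall y \near x, A y by exact: open_nbhs_nbhs.
    by apply: filterS => y Ay; apply/esym/derive_val/derive2_comb.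
  rewrite /prop_for /continuous_at -(nbhs_singleton E).
  apply: cvg_trans; first exact: (near_eq_cvg E).
  by apply: cvgD; [exact: u4|apply: cvgM; [exact: cvg_cst|exact: v4]].
Qed.

Lemma laplacian_comb (x : R * R * R) : A x ->
  laplacian w x = laplacian u x + c * laplacian v x.
Proof.
move=> Ax; rewrite /laplacian mulr_sumr -big_split /=.
by apply: eq_bigr => i _; exact/derive_val/derive2_comb.
Qed.

End C2_combination.

(** If the second derivative were positive, then the first derivative, which
    vanishes at x, would be positive just after x along the line, and the mean
    value theorem would give values above the maximum. *)
Lemma derive2_le0_at_max (R : realType) (V : normedModType R) (A : set V)
    (w dw : V -> R) (x e : V) (d2 : R) :
  open A -> A x -> (forall y, A y -> is_derive y e w (dw y)) ->
  is_derive x e dw d2 -> (forall y, A y -> w y <= w x) -> d2 <= 0.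
Proof.
move=> oA Ax Dw Ddw wmax; rewrite leNgt; apply/negP => d2_gt0.
pose p (t : R) := w (t *: e + x); pose q (t : R) := dw (t *: e + x).
have [d /= d0 dA] : exists2 d, 0 < d & forall t : R, `|t| < d -> A (t *: e + x).
  have cl : (t *: e + x) @[t --> (0 : R)] --> x.
    rewrite -[X in _ --> X](_ : 0 *: e + x = x); last by rewrite scale0r add0r.
    by apply: cvgD; [apply: cvgZr_tmp; exact: cvg_id|exact: cvg_cst].
  have /cl [d d0 dA] : nbhs x A by exact: open_nbhs_nbhs.
  by exists d => // t td; apply: dA; rewrite /ball_ /= sub0r normrN.
have dp t : `|t| < d -> is_derive t (1 : R) p (q t).
  by move=> td; apply/is_derive_lineP/Dw/dA.
have dq : is_derive (0 : R) (1 : R) q d2.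
  apply: (iffRL (is_derive_lineP dw x e 0 _)).
  by rewrite scale0r add0r.
have q0 : q 0 = 0.
  have p0 : is_derive (0 : R) (1 : R) p 0.
    apply: (@derive1_at_max _ p (- d) d).
    - by rewrite -subr_ge0 opprK addr_ge0 // ltW.
    - by move=> t; rewrite in_itv /= -ltr_norml => /dp [].
    - by rewrite in_itv /= oppr_lt0 d0.
    - move=> t; rewrite in_itv /= -ltr_norml => td.
      by rewrite /p scale0r add0r; apply/wmax/dA.
  have [_ <-] := dp 0 (ltac:(by rewrite normr0)).
  by case: p0.
have [s /= s0 sq] : exists2 s, 0 < s & forall t : R, 0 < t -> t < s -> 0 < q t.
  case: dq => dq E.
  have : h^-1 *: ((q \o shift 0) (h *: 1) - q 0) @[h --> 0^'] --> d2.
    by rewrite -E; exact: dq.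
  move=> /cvgr_gt /(_ 0 d2_gt0) [s s0 sq]; exists s => // t t0 ts.
  have := sq t; rewrite /ball_ /= sub0r normrN gtr0_norm // => /(_ ts (lt0r_neq0 t0)).
  by rewrite /= q0 subr0 addr0 [_%:A]mulr1 pmulr_rgt0 // invr_gt0.
pose t := Num.min s d / 2.
have m0 : 0 < Num.min s d by rewrite lt_min s0 d0.
have t0 : 0 < t by rewrite divr_gt0.
have tm : t < Num.min s d by rewrite /t; lra.
have [ts td] : t < s /\ t < d by move: tm; rewrite lt_min => /andP.
have [||c] := @MVT _ p q 0 t t0.
- move=> c; rewrite in_itv /= => /andP[c0 ct]; apply: dp.
  by rewrite gtr0_norm // (lt_trans ct).
- apply: derivable_within_continuous => c; rewrite in_itv /= => /andP[c0 ct].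
  by case: (dp c) => //; rewrite ger0_norm // (le_lt_trans ct).
rewrite in_itv /= => /andP[c0 ct] E.
have : 0 < p t - p 0.
  by rewrite E subr0 mulr_gt0 // sq // (lt_trans ct).
rewrite subr_gt0 ltNge /p scale0r add0r wmax //.
by apply: dA; rewrite gtr0_norm.
Qed.

Lemma laplacian_le0_at_max (R : realType) (A : set (pt R)) (w : R * R * R -> R) (x : pt R) :
  open (A : set (R * R * R)) -> C2_on A w -> A x -> (forall y, A y -> w y <= w x) ->
  laplacian w x <= 0.
Proof.
move=> oA Cw Ax wmax; apply: sumr_le0 => i _.
have dW y : A y -> is_derive y (axis R i) w ('D_(axis R i) w y).
  by move=> Ay; apply: derivableP; case: (Cw y Ay i i).
have ddW : is_derive x (axis R i) ('D_(axis R i) w) ('D_(axis R i) ('D_(axis R i) w) x).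
  by apply: derivableP; case: (Cw x Ax i i).
exact: (derive2_le0_at_max oA Ax dW ddW wmax).
Qed.

Lemma radiusZ (R : realType) (c : R) (x : pt R) : radius (c *: x) = `|c| * radius x.
Proof.
rewrite /radius -sqrtr_sqr -sqrtrM ?sqr_ge0// /=; congr Num.sqrt.
by rewrite /GRing.scale /=; ring.
Qed.

(** The points x - t n of the difference quotient lie on the ray through x, where
    the radius is affine in t. *)
Lemma radius_inward (R : realType) (r t : R) (x : pt R) : radius x = r -> 0 < r ->
  0 <= t -> t <= r ->
  radius (x - t *: outward_normal2 r x) = r - t /\
  radius (x - t *: outward_normal1 r x) = r + t.
Proof.
move=> xr r0 t0 tr.
rewrite /outward_normal1 /outward_normal2 scalerN opprK scalerA.
have -> : x + (t * r^-1) *: x = (1 + t / r) *: x by rewrite scalerDl scale1r.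
have -> : x - (t * r^-1) *: x = (1 - t / r) *: x by rewrite scalerBl scale1r.
have h : 0 <= t / r <= 1.
  by apply/andP; split; [rewrite divr_ge0// ltW|rewrite ler_pdivrMr// mul1r].
rewrite !radiusZ xr !ger0_norm; [|lra|lra].
by have := lt0r_neq0 r0 => rn0; split; field.
Qed.

Lemma normal_derivative_radial (R : realType) (phi : R -> R) (x n : pt R) (k d : R) :
  is_derive (radius x) (1 : R) phi d ->
  (\forall t \near 0^'+, radius (x - t *: n) = radius x + k * t) ->
  is_normal_derivative (fun y => phi (radius y)) x n (- (k * d)).
Proof.
move=> dphi xn; rewrite /is_normal_derivative.
pose f (t : R) := phi (radius x + k * t).
have df : is_derive (0 : R) (1 : R) f (d * k).
  apply: (@is_derive1_comp _ phi (fun t : R => radius x + k * t)).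
    by rewrite mulr0 addr0.
  by apply: is_derive_eq; rewrite /GRing.scale /=; ring.
have dfc : - (h^-1 * (f h - f 0)) @[h --> 0^'+] --> - (k * d).
  apply: cvgN; rewrite mulrC.
  case: df => df <-; apply: cvg_trans df; rewrite (_ : (fun h => _ * _) =
    (fun h => h^-1 *: ((f \o shift 0) (h *: 1) - f 0))); last first.
    by apply/funext => h /=; rewrite addr0 [_%:A]mulr1.
  apply: cvg_app => A [e e0 Ae]; exists e => // y ye y0; apply: Ae => //.
  exact/lt0r_neq0.
apply: cvg_trans dfc; apply: near_eq_cvg.
near=> t.
have -> : radius (x - t *: n) = radius x + k * t by near: t.
by rewrite /f mulr0 addr0 -mulrN opprB mulrC.
Unshelve. all: by end_near. Qed.

(** The radial functions with constant Laplacian. *)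
Definition profile (R : realType) (a b c r : R) : R := a + b * r ^+ 2 + c / r.

Definition dprofile (R : realType) (b c r : R) : R := 2 * b * r - c / r ^+ 2.

Lemma is_derive_profile (R : realType) (a b c r : R) : 0 < r ->
  is_derive r (1 : R) (profile a b c) (dprofile b c r).
Proof.
move=> r0; have rn0 := lt0r_neq0 r0.
have dV : is_derive r (1 : R) (fun r : R => r^-1) (- r ^- 2).
  have /(is_deriveV rn0) := is_derive_id r (1 : R).
  by rewrite /GRing.scale /= mulr1.
have -> : profile a b c = (fun r => a + b * r ^+ 2 + c * r^-1) by [].
by apply: is_derive_eq; rewrite /dprofile /GRing.scale /=; field.
Qed.

Section profile_harmonic.
Context (R : realType) (a b c : R).
Let u : R * R * R -> R := fun x => profile a b c (radius x).
Let psi (r : R) := 2 * b - c / r ^+ 3.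
Let chi (r : R) := 3 * c / r ^+ 5.

Let dphi (r : R) : 0 < r -> is_derive r (1 : R) (profile a b c) (r * psi r).
Proof.
move=> r0; have := is_derive_profile a b c r0; congr (is_derive _ _ _ _).
by have := lt0r_neq0 r0; rewrite /dprofile /psi => rn0; field.
Qed.

Let dpsi (r : R) : 0 < r -> is_derive r (1 : R) psi (r * chi r).
Proof.
move=> r0; have rn0 := lt0r_neq0 r0.
have dV : is_derive r (1 : R) (fun r : R => (r ^+ 3)^-1) (- 3 / r ^+ 4).
  have h : r ^+ 3 != 0 by rewrite expf_neq0.
  have dX : is_derive r (1 : R) (fun r : R => r ^+ 3) (3 * r ^+ 2).
    by apply: is_derive_eq; rewrite /GRing.scale /=; ring.
  have := @is_deriveV _ (fun r : R => r ^+ 3) r _ 1 h dX; congr (is_derive _ _ _ _).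
  by rewrite /GRing.scale /=; field.
have -> : psi = (fun r => 2 * b - c * (r ^+ 3)^-1) by [].
by apply: is_derive_eq; rewrite /chi /GRing.scale /=; field.
Qed.

Let cchi (r : R) : 0 < r -> {for r, continuous chi}.
Proof.
move=> r0; rewrite /prop_for /continuous_at /chi; apply: cvgM; first exact: cvg_cst.
by apply: cvgV; [rewrite expf_neq0 ?lt0r_neq0|exact: exprn_continuous].
Qed.

Lemma C2_profile (A : set (pt R)) : (forall x, A x -> 0 < radius x) -> C2_on A u.
Proof. exact: (C2_radial dphi dpsi cchi). Qed.

Lemma laplacian_profile (x : pt R) : 0 < radius x -> laplacian u x = 6 * b.
Proof.
move=> r0; rewrite (laplacian_radial dphi dpsi r0) /psi /chi.
by have := lt0r_neq0 r0 => rn0; field.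
Qed.

Lemma continuous_profile (r1 r2 : R) : 0 < r1 -> {within closed_shell r1 r2, continuous u}.
Proof.
move=> r1_gt0; apply/continuous_in_subspaceT => x; rewrite inE => /andP[r1x _].
have r0 : 0 < radius x by exact: lt_le_trans r1x.
apply: (@continuous_comp _ _ _ (@radius R : R * R * R -> R) (profile a b c)).
  exact: continuous_radius.
by apply/differentiable_continuous/derivable1_diffP; case: (dphi r0).
Qed.

Lemma normal_derivative1_profile (r : R) (x : pt R) : 0 < r -> sphere r x ->
  is_normal_derivative u x (outward_normal1 r x) (- dprofile b c r).
Proof.
move=> r0 xr; rewrite -[dprofile b c r]mul1r; apply: normal_derivative_radial.
  by rewrite xr; exact: is_derive_profile.
near=> t; rewrite mul1r xr.
have t0 : 0 <= t by near: t; exact: nbhs_right_ge.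
have tr : t <= r by near: t; exact: nbhs_right_le.
exact: (radius_inward xr r0 t0 tr).2.
Unshelve. all: by end_near. Qed.

Lemma normal_derivative2_profile (r : R) (x : pt R) : 0 < r -> sphere r x ->
  is_normal_derivative u x (outward_normal2 r x) (dprofile b c r).
Proof.
move=> r0 xr; rewrite -[dprofile b c r]opprK -(mulN1r (dprofile b c r)).
apply: normal_derivative_radial.
  by rewrite xr; exact: is_derive_profile.
near=> t; rewrite mulN1r xr.
have t0 : 0 <= t by near: t; exact: nbhs_right_ge.
have tr : t <= r by near: t; exact: nbhs_right_le.
exact: (radius_inward xr r0 t0 tr).1.
Unshelve. all: by end_near. Qed.

End profile_harmonic.

Lemma normal_derivative_comb (R : realType) (u v : pt R -> R) (c : R)
    (x n : pt R) (du dv : R) :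
  is_normal_derivative u x n du -> is_normal_derivative v x n dv ->
  is_normal_derivative (fun y => u y + c * v y) x n (du + c * dv).
Proof.
move=> Du Dv; rewrite /is_normal_derivative.
rewrite [X in X @ _](_ : _ = (fun t => (u x - u (x - t *: n)) / t
    + c * ((v x - v (x - t *: n)) / t))).
  by apply: cvgD; [exact: Du|apply: cvgM; [exact: cvg_cst|exact: Dv]].
by apply/funext => t; rewrite mulrA -mulrDl; congr (_ / _); ring.
Qed.

Lemma normal_derivative_ge0 (R : realType) (A : set (pt R)) (f : pt R -> R)
    (x n : pt R) (d : R) :
  (forall y, A y -> f y <= f x) -> (\forall t \near 0^'+, A (x - t *: n)) ->
  is_normal_derivative f x n d -> 0 <= d.
Proof.
move=> fmax xA /cvgr_to_ge; apply; near=> t.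
have t0 : 0 < t by [].
by rewrite divr_ge0 ?subr_ge0 ?(ltW t0) //; apply: fmax; near: t.
Unshelve. all: by end_near. Qed.

Lemma within_continuous_comb (R : realType) (A : set (R * R * R))
    (u v : R * R * R -> R) (c : R) :
  {within A, continuous u} -> {within A, continuous v} ->
  {within A, continuous (fun x => u x + c * v x)}.
Proof.
move=> cu cv x; apply: cvgD; first exact: cu.
by apply: cvgM; [exact: cvg_cst|exact: cv].
Qed.

(** The condition u + k du/dn = b at a point x of the inner sphere. The disjunction
    matters: for k = 0 the solution need not have a normal derivative there, and
    the condition reduces to u x = b. *)
Definition gamma1_condition (R : realType) (r1 k b : R) (u : pt R -> R) (x : pt R) : Prop :=
  exists d, (k = 0 \/ is_normal_derivative u x (outward_normal1 r1 x) d) /\ u x = b - k * d.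

Section shell_maximum_principle.
Context (R : realType) (r1 r2 : R).
Hypotheses (r1_gt0 : 0 < r1) (r12 : r1 < r2).

Let r2_gt0 : 0 < r2. Proof. exact: lt_trans r12. Qed.

Lemma shell_radius_gt0 (x : pt R) : shell r1 r2 x -> 0 < radius x.
Proof. by case/andP => h _; exact: lt_trans h. Qed.

Lemma closed_shell_radius_gt0 (x : pt R) : closed_shell r1 r2 x -> 0 < radius x.
Proof. by case/andP => h _; exact: lt_le_trans h. Qed.

Lemma near_inside1 (x : pt R) : sphere r1 x ->
  \forall t \near 0^'+, closed_shell r1 r2 (x - t *: outward_normal1 r1 x).
Proof.
move=> xr; near=> t.
have t0 : 0 <= t by [].
have tr : t <= r1 by near: t; exact: nbhs_right_le.
have td : t <= r2 - r1 by near: t; apply: nbhs_right_le; rewrite subr_gt0.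
by rewrite /closed_shell /= (radius_inward xr r1_gt0 t0 tr).2; lra.
Unshelve. all: by end_near. Qed.

Lemma near_inside2 (x : pt R) : sphere r2 x ->
  \forall t \near 0^'+, closed_shell r1 r2 (x - t *: outward_normal2 r2 x).
Proof.
move=> xr; near=> t.
have t0 : 0 <= t by [].
have tr : t <= r2 by near: t; exact: nbhs_right_le.
have td : t <= r2 - r1 by near: t; apply: nbhs_right_le; rewrite subr_gt0.
by rewrite /closed_shell /= (radius_inward xr r2_gt0 t0 tr).1; lra.
Unshelve. all: by end_near. Qed.

Lemma closed_shell_nonempty : (closed_shell r1 r2 : set (R * R * R)) !=set0.
Proof.
exists (r1, 0, 0); rewrite /closed_shell /= /radius /= expr0n /= !addr0.
by rewrite sqrtr_sqr gtr0_norm // lexx ltW.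
Qed.

(** The barrier has the Laplacian 3, and on the outer sphere the normal derivative
    r2 - 2 r2^3 / r2^2 = - r2. *)
Let barrier : R * R * R -> R := fun x => profile 0 (1 / 2) (2 * r2 ^+ 3) (radius x).

(** A maximum inside the shell contradicts the positive Laplacian, a maximum on
    the outer sphere contradicts the negative normal derivative. *)
Lemma barrier_max (w : R * R * R -> R) (e : R) : 0 < e ->
  C2_on (shell r1 r2) w -> {within closed_shell r1 r2, continuous w} ->
  (forall x, shell r1 r2 x -> laplacian w x = 0) ->
  (forall x, sphere r2 x -> is_normal_derivative w x (outward_normal2 r2 x) 0) ->
  exists2 x, sphere r1 x &
    forall y, closed_shell r1 r2 y -> w y + e * barrier y <= w x + e * barrier x.
Proof.
move=> e0 Cw cw Lw Nw.
have Cb : C2_on (shell r1 r2) barrier by apply: C2_profile; exact: shell_radius_gt0.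
have cb : {within closed_shell r1 r2, continuous barrier}.
  exact: continuous_profile.
have cf := within_continuous_comb (c := e) cw cb.
have [x + xmax] := compact_EVT_max closed_shell_nonempty (@compact_closed_shell R r1 r2) cf.
rewrite inE => xA; exists x; last by move=> y yA; apply: xmax; rewrite inE.
have {}xmax y : closed_shell r1 r2 y -> w y + e * barrier y <= w x + e * barrier x.
  by move=> yA; apply: xmax; rewrite inE.
case/andP: (xA) => r1x xr2.
move: r1x; rewrite le_eqVlt => /predU1P[/esym //|r1x].
move: xr2; rewrite le_eqVlt => /predU1P[xr2|xr2].
  have Nb : is_normal_derivative barrier x (outward_normal2 r2 x) (- r2).
    have := @normal_derivative2_profile _ 0 (1 / 2) (2 * r2 ^+ 3) _ _ r2_gt0 xr2.
    rewrite (_ : dprofile _ _ _ = - r2) // /dprofile.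
    by have := lt0r_neq0 r2_gt0 => rn0; field.
  have := normal_derivative_ge0 xmax (near_inside2 xr2)
    (normal_derivative_comb (c := e) (Nw _ xr2) Nb).
  by rewrite add0r mulrN oppr_ge0 leNgt mulr_gt0.
have xS : shell r1 r2 x by rewrite /shell /= r1x.
have := laplacian_le0_at_max (@open_shell R r1 r2) (C2_comb e (@open_shell R r1 r2) Cw Cb) xS.
rewrite (laplacian_comb e (@open_shell R r1 r2) Cw Cb xS) Lw //.
rewrite laplacian_profile ?(shell_radius_gt0 xS) // => /(_ _)/wrap[].
  by move=> y /andP[h1 h2]; apply: xmax; rewrite /closed_shell /= !ltW.
by rewrite leNgt => /negP[]; lra.
Qed.

(** On the inner sphere the maximum point x of w + e barrier satisfies
    dw/dn + e d(barrier)/dn >= 0, so that w x = - k dw/dn is at most a multiple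
    of e; for k = 0 the value w x is 0. The bound e C then holds everywhere, for
    all e > 0. *)
Lemma shell_le0 (w : R * R * R -> R) (k : R) : 0 <= k ->
  C2_on (shell r1 r2) w -> {within closed_shell r1 r2, continuous w} ->
  (forall x, shell r1 r2 x -> laplacian w x = 0) ->
  (forall x, sphere r2 x -> is_normal_derivative w x (outward_normal2 r2 x) 0) ->
  (forall x, sphere r1 x -> gamma1_condition r1 k 0 w x) ->
  forall x, closed_shell r1 r2 x -> w x <= 0.
Proof.
move=> k0 Cw cw Lw Nw bc y yA.
pose p : R -> R := profile 0 (1 / 2) (2 * r2 ^+ 3).
(* the outward normal derivative of the barrier on the inner sphere *)
pose s := 2 * r2 ^+ 3 / r1 ^+ 2 - r1.
have s_ge0 : 0 <= s.
  rewrite subr_ge0 ler_pdivlMr ?exprn_gt0 // -exprS.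
  have : r1 ^+ 3 <= r2 ^+ 3 by rewrite ler_pXn2r ?nnegrE ?ltW.
  have : 0 < r2 ^+ 3 by rewrite exprn_gt0.
  by lra.
pose C := p r1 + k * s.
have C_ge0 : 0 <= C.
  by rewrite addr_ge0 ?mulr_ge0 // /p /profile add0r addr_ge0 ?divr_ge0 ?mulr_ge0
    ?exprn_ge0 // ltW.
have barrier_ge0 : 0 <= barrier y.
  rewrite /barrier /profile; have := closed_shell_radius_gt0 yA => y0.
  by rewrite add0r addr_ge0// ?divr_ge0 ?mulr_ge0 ?exprn_ge0 // ltW.
suff H e : 0 < e -> w y <= e * C.
  apply/ler_addgt0Pr => e e0; rewrite add0r.
  apply: le_trans (H (e / (C + 1)) _) _; first by rewrite divr_gt0 // ltr_wpDl.
  rewrite mulrAC ler_pdivrMr; last by rewrite ltr_wpDl.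
  by apply: ler_wpM2l; [exact: ltW|rewrite lerDl].
move=> e0.
have [x xr xmax] := barrier_max e0 Cw cw Lw Nw.
have bx : barrier x = p r1 by rewrite /barrier -/p xr.
suff wx : w x <= e * (k * s).
  have h : 0 <= e * barrier y by rewrite mulr_ge0 // ltW.
  apply: (@le_trans _ _ (w y + e * barrier y)); first by rewrite lerDl.
  by rewrite (le_trans (xmax _ yA)) // bx /C (mulrDr e (p r1)) addrC lerD2l.
have [d [[->|Nd] ->]] := bc _ xr; first by rewrite !mul0r subrr mulr0.
rewrite sub0r.
have Nb := @normal_derivative1_profile _ 0 (1 / 2) (2 * r2 ^+ 3) _ _ r1_gt0 xr.
have := normal_derivative_ge0 xmax (near_inside1 xr) (normal_derivative_comb (c := e) Nd Nb).
rewrite (_ : dprofile _ _ _ = - s); last by rewrite /dprofile /s; field; rewrite lt0r_neq0.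
by rewrite opprK => h; rewrite mulrCA -mulrN ler_wpM2l // -subr_ge0 opprK addrC.
Qed.

Definition solves_mixed (k g q b : R) (u : R * R * R -> R) : Prop :=
  [/\ poisson_eq r1 r2 g u,
      forall x, sphere r1 x -> gamma1_condition r1 k b u x &
      forall x, sphere r2 x -> is_normal_derivative u x (outward_normal2 r2 x) (- q)].

Lemma solves_mixed_le (k g q b : R) (u v : R * R * R -> R) : 0 <= k ->
  solves_mixed k g q b u -> solves_mixed k g q b v ->
  forall x, closed_shell r1 r2 x -> u x <= v x.
Proof.
move=> k0 [[Cu cu Lu] bu Nu] [[Cv cv Lv] bv Nv] x xA.
suff : u x + (-1) * v x <= 0 by rewrite mulN1r subr_le0.
apply: (@shell_le0 (fun x => u x + (-1) * v x) k k0) xA.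
- exact: (C2_comb (-1) (@open_shell R r1 r2) Cu Cv).
- exact: (within_continuous_comb cu cv).
- move=> y yS; rewrite (laplacian_comb (-1) (@open_shell R r1 r2) Cu Cv yS).
  have -> : laplacian u y = - g by rewrite -(Lu _ yS) opprK.
  have -> : laplacian v y = - g by rewrite -(Lv _ yS) opprK.
  by rewrite mulN1r subrr.
- move=> y yr; rewrite -[0](subrr (- q)) -(mulN1r (- q)).
  by apply: normal_derivative_comb; [exact: Nu|exact: Nv].
- move=> y yr; have [du [Hu Eu]] := bu _ yr; have [dv [Hv Ev]] := bv _ yr.
  exists (du + (-1) * dv); split; last by rewrite Eu Ev; ring.
  case: Hu => [|Hu]; first by left.
  case: Hv => [|Hv]; first by left.
  by right; exact: normal_derivative_comb.
Qed.

Lemma solves_mixed_unique (k g q b : R) (u v : R * R * R -> R) : 0 <= k ->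
  solves_mixed k g q b u -> solves_mixed k g q b v ->
  forall x, closed_shell r1 r2 x -> u x = v x.
Proof.
move=> k0 Pu Pv x xA; apply/eqP; rewrite eq_le.
by rewrite (solves_mixed_le k0 Pu Pv xA) (solves_mixed_le k0 Pv Pu xA).
Qed.

(** B is forced by the source, then C by the outer flux, then A by the inner
    condition. *)
Definition mixed_profile (k g q b : R) : R -> R :=
  let B := - g / 6 in
  let C := r2 ^+ 2 * (2 * B * r2 + q) in
  profile (b + k * dprofile B C r1 - profile 0 B C r1) B C.

Lemma solves_mixed_profile (k g q b : R) :
  solves_mixed k g q b (fun x => mixed_profile k g q b (radius x)).
Proof.
split.
- split; first by apply: C2_profile; exact: shell_radius_gt0.
  + exact: continuous_profile.
  + by move=> x xS; rewrite laplacian_profile ?(shell_radius_gt0 xS) //; field.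
- move=> x xr; eexists; split.
    by right; exact: normal_derivative1_profile.
  rewrite xr /mixed_profile /profile; ring.
- move=> x xr; rewrite (_ : - q = dprofile (- g / 6) (r2 ^+ 2 * (2 * (- g / 6) * r2 + q)) r2).
    exact: normal_derivative2_profile.
  by rewrite /dprofile; field; exact: lt0r_neq0.
Qed.

Lemma unique_solution_mixed (P : (pt R -> R) -> Prop) (k g q b : R) : 0 <= k ->
  (forall u, P u <-> solves_mixed k g q b u) ->
  forall x, closed_shell r1 r2 x ->
  unique_solution (closed_shell r1 r2) P x = mixed_profile k g q b (radius x).
Proof.
move=> k0 HP x xA; rewrite /unique_solution.
set S := [set u | _].
pose U : pt R -> R := fun x => mixed_profile k g q b (radius x).
have PU := solves_mixed_profile k g q b.
have SU : S U.
  split; first exact/HP.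
  by move=> v /HP Pv y yA; exact: (solves_mixed_unique k0 Pv PU yA).
have [/HP Pu _] := xgetPex (fun=> 0) (ex_intro S U SU).
exact: (solves_mixed_unique k0 Pu PU xA).
Qed.

Lemma stateE (g q b : R) (x : pt R) : closed_shell r1 r2 x ->
  state r1 r2 g q b x = mixed_profile 0 g q b (radius x).
Proof.
apply: unique_solution_mixed => // u; split.
- move=> [H1 H2 H3]; split => // y yr; exists 0; split; first by left.
  by rewrite mul0r subr0 H2.
- move=> [H1 H2 H3]; split => // y yr; have [d [_ ->]] := H2 _ yr.
  by rewrite mul0r subr0.
Qed.

Lemma robin_stateE (alpha g q b : R) (x : pt R) : 0 < alpha -> closed_shell r1 r2 x ->
  robin_state r1 r2 alpha g q b x = mixed_profile alpha^-1 g q b (radius x).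
Proof.
move=> a0; have an0 := lt0r_neq0 a0.
apply: unique_solution_mixed => [|u]; first by rewrite invr_ge0 ltW.
split.
- move=> [H1 H2 H3]; split => // y yr; eexists; split; first by right; exact: H2.
  by field.
- move=> [H1 H2 H3]; split => // y yr; have [d [[K0|Nd] E]] := H2 _ yr.
    by move: an0; rewrite -invr_eq0 K0 eqxx.
  rewrite (_ : - _ = d) // E; by field.
Qed.

End shell_maximum_principle.

(** * The volume of balls *)

Lemma FTC2_continuous (R : realType) (F f : R -> R) (a b : R) : a <= b ->
  (forall x, is_derive x (1 : R) F (f x)) -> continuous f ->
  (\int[@lebesgue_measure R]_(x in `[a, b]) (f x)%:E = (F b - F a)%:E)%E.
Proof.
move=> + dF cf; rewrite le_eqVlt => /predU1P[<-|ab].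
  by rewrite set_itv1 integral_set1 subrr.
rewrite EFinB; apply: continuous_FTC2 => //.
- by apply: continuous_subspaceT.
- have cF : continuous F.
    by move=> x; apply/differentiable_continuous/derivable1_diffP; case: (dF x).
  split.
  + by move=> x _; case: (dF x).
  + by apply: cvg_at_right_filter; exact: cF.
  + by apply: cvg_at_left_filter; exact: cF.
- by move=> x _; rewrite derive1E; case: (dF x).
Qed.

Lemma continuous_semicircle (R : realType) (D : R) :
  continuous (fun y : R => 2 * Num.sqrt (D - y ^+ 2)).
Proof.
move=> y; apply: cvgM; first exact: cvg_cst.
apply: (@continuous_comp _ _ _ (fun y : R => D - y ^+ 2) Num.sqrt);
  last exact: sqrt_continuous.
by apply: cvgB; [exact: cvg_cst|exact: exprn_continuous].
Qed.

(** The area of the disc of radius sqrt D, by the substitution y = sqrt D sin t.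
    For D <= 0 the integrand vanishes since the square root of a negative number
    is 0, which makes the formula valid for all D. *)
Lemma integral_semicircle (R : realType) (D : R) :
  (\int[@lebesgue_measure R]_y (2 * Num.sqrt (D - y ^+ 2))%:E = (pi * Num.max D 0)%:E)%E.
Proof.
have [D0|D0] := leP D 0.
  rewrite mulr0; apply: integral0_eq => y _; rewrite ler0_sqrtr ?mulr0 //.
  by rewrite subr_le0 (le_trans D0) ?sqr_ge0.
pose w : R := Num.sqrt D; have w0 : 0 < w by rewrite sqrtr_gt0.
have wD : w ^+ 2 = D by rewrite sqr_sqrtr // ltW.
have cos_nneg (x : R) : x \in `[(- (pi / 2)), pi / 2] -> 0 <= cos x.
  by rewrite in_itv /= => /cos_ge0_pihalf.
have pi0 := pi_gt0 R.
pose f (y : R) : R := 2 * Num.sqrt (D - y ^+ 2).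
pose F (t : R) : R := w * sin t.
have dF t : is_derive t (1 : R) F (w * cos t).
  by apply: is_derive_eq; rewrite /GRing.scale /=; ring.
have F'E : (derive1 F) = fun t => w * cos t.
  by apply/funext => t; rewrite derive1E; case: (dF t).
have cF' : continuous (derive1 F).
  by rewrite F'E => t; apply: cvgM; [exact: cvg_cst|exact: continuous_cos].
have cF : continuous F.
  by move=> t; apply: cvgM; [exact: cvg_cst|exact: continuous_sin].
have Fa : F (- (pi / 2)) = - w by rewrite /F sinN sin_pihalf mulrN1.
have Fb : F (pi / 2) = w by rewrite /F sin_pihalf mulr1.
transitivity (\int[@lebesgue_measure R]_(y in `[(- w)%R, w]) (f y)%:E)%E.
  rewrite [RHS]integral_mkcond; apply: eq_integral => y _; rewrite patchE.
  case: ifPn => //; rewrite notin_setE /= in_itv /= -ler_norml => /negP; rewrite -ltNge => h.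
  rewrite ler0_sqrtr ?mulr0 // subr_le0 -wD -(real_normK (num_real y)).
  by rewrite ler_pXn2r ?nnegrE // ltW.
have sub : (\int[@lebesgue_measure R]_(y in `[(F (- (pi / 2)))%R, (F (pi / 2))%R]) (f y)%:E =
    \int[@lebesgue_measure R]_(t in `[(- (pi / 2))%R, (pi / 2)%R])
      (((f \o F) * (derive1 F)) t)%:E)%E.
  apply: integration_by_substitution_increasing.
  - by lra.
  - by move=> x y xI yI xy; rewrite ltr_pM2l // ltr_sin.
  - by move=> x _; exact: cF'.
  - by apply/cvg_ex; exists ((derive1 F) (- (pi / 2))); apply: cvg_at_right_filter; exact: cF'.
  - by apply/cvg_ex; exists ((derive1 F) (pi / 2)); apply: cvg_at_left_filter; exact: cF'.
  - split; first by move=> x _; case: (dF x).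
    + by apply: cvg_at_right_filter; exact: cF.
    + by apply: cvg_at_left_filter; exact: cF.
  - by apply: continuous_subspaceT; exact: continuous_semicircle.
move: sub; rewrite Fa Fb => ->.
transitivity (\int[@lebesgue_measure R]_(t in `[(- (pi / 2))%R, (pi / 2)%R])
    (2 * D * cos t ^+ 2)%:E)%E.
  apply: eq_integral => t /[1!inE] /= tI; congr (_ %:E).
  have E : D - F t ^+ 2 = (w * cos t) ^+ 2 by rewrite /F -wD !exprMn cos2sin2; ring.
  transitivity (f (F t) * (w * cos t)); first by rewrite F'E.
  rewrite /f E sqrtr_sqr ger0_norm ?mulr_ge0 ?cos_nneg ?(ltW w0) // -wD; ring.
have dG (t : R) :
    is_derive t (1 : R) (fun t => D * (t + sin t * cos t)) (2 * D * cos t ^+ 2).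
  by apply: is_derive_eq; rewrite /GRing.scale /=; have /(congr1 ( *%R D)) := cos2Dsin2 t; lra.
have cG : continuous (fun t : R => 2 * D * cos t ^+ 2).
  move=> t; apply: cvgM; first exact: cvg_cst.
  by apply: (@continuous_comp _ _ _ cos (fun x => x ^+ 2));
    [exact: continuous_cos|exact: exprn_continuous].
rewrite (FTC2_continuous _ dG cG); last by lra.
by rewrite sinN cosN cos_pihalf; congr (_ %:E); field.
Qed.

Lemma radius_lt_sqr (R : realType) (r : R) (p : R * R) (z : R) : 0 <= r ->
  (radius (p, z) < r) = (z ^+ 2 < r ^+ 2 - p.1 ^+ 2 - p.2 ^+ 2).
Proof.
move=> r0; rewrite -(@ltr_pXn2r _ 2) ?nnegrE ?sqrtr_ge0 // sqr_sqrtr ?addr_ge0 ?sqr_ge0 //=.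
by apply/idP/idP; lra.
Qed.

Lemma radius_le_sqr (R : realType) (r : R) (p : R * R) (z : R) : 0 <= r ->
  (radius (p, z) <= r) = (z ^+ 2 <= r ^+ 2 - p.1 ^+ 2 - p.2 ^+ 2).
Proof.
move=> r0; rewrite -(@ler_pXn2r _ 2) ?nnegrE ?sqrtr_ge0 // sqr_sqrtr ?addr_ge0 ?sqr_ge0 //=.
by apply/idP/idP; lra.
Qed.

Local Notation T2 R := (measurableTypeR R * measurableTypeR R)%type.
Local Notation T3 R := (measurableTypeR R * measurableTypeR R * measurableTypeR R)%type.

(** Sandwiching A between the open and the closed ball treats both at once; the
    end points of a slice have length 0. *)
Lemma slice_length (R : realType) (A : set (T3 R)) (r : R) (p : T2 R) : 0 <= r ->
  measurable A -> (forall x, radius x < r -> A x) -> (forall x, A x -> radius x <= r) ->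
  lebesgue_measure (xsection A p) = (2 * Num.sqrt (r ^+ 2 - p.1 ^+ 2 - p.2 ^+ 2))%:E.
Proof.
move=> r0 mA lA uA; set D := r ^+ 2 - _ - _; set s := Num.sqrt D.
have s0 : 0 <= s by exact: sqrtr_ge0.
have mX : measurable (xsection A p) by exact: measurable_xsection.
apply/eqP; rewrite eq_le; apply/andP; split.
- apply: le_trans (_ : (lebesgue_measure `[(- s)%R, s] <= _)%E).
    apply: le_measure; rewrite ?inE //= => z; rewrite /xsection /= inE => /uA.
    rewrite radius_le_sqr // -/D in_itv /= -ler_norml => zD.
    by rewrite -sqrtr_sqr ler_wsqrtr.
  rewrite lebesgue_measure_itv /= lte_fin.
  by case: ifPn => _; rewrite -?EFinD lee_fin; [lra|rewrite mulr_ge0].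
- apply: le_trans (_ : (lebesgue_measure `](- s)%R, s[ <= _)%E).
    rewrite lebesgue_measure_itv /= lte_fin; by case: ifPn => ?; rewrite -?EFinD lee_fin; lra.
  apply: le_measure; rewrite ?inE //= => z; rewrite /xsection /= inE.
  rewrite in_itv /= -ltr_norml => zs.
  apply: lA; rewrite radius_lt_sqr // -/D -real_normK ?num_real //.
  have D0 : 0 < D by rewrite -sqrtr_gt0 (le_lt_trans _ zs).
  by rewrite -(sqr_sqrtr (ltW D0)) ltr_pXn2r ?nnegrE.
Qed.

(** The slices along the third axis have the length 2 sqrt (r^2 - x^2 - y^2);
    integrating over y gives the areas pi (r^2 - x^2) of the plane sections. *)
Lemma volume_ball (R : realType) (A : set (T3 R)) (r : R) : 0 <= r ->
  measurable A -> (forall x, radius x < r -> A x) -> (forall x, A x -> radius x <= r) ->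
  volume A = (4 / 3 * pi * r ^+ 3)%:E.
Proof.
move=> r0 mA lA uA.
pose h (p : T2 R) : R := 2 * Num.sqrt (r ^+ 2 - p.1 ^+ 2 - p.2 ^+ 2).
have mh : measurable_fun setT h.
  apply: measurable_funM => //.
  apply: (measurableT_comp (f := @Num.sqrt R : measurableTypeR R -> measurableTypeR R)
    (g := fun p : T2 R => r ^+ 2 - p.1 ^+ 2 - p.2 ^+ 2)).
    by apply: continuous_measurable_fun; exact: sqrt_continuous.
  apply: measurable_funB; [apply: measurable_funB|] => //;
    apply: measurable_funX; [exact: measurable_fst|exact: measurable_snd].
transitivity (\int[lebesgue_measure \x lebesgue_measure]_p (h p)%:E)%E.
  transitivity (\int[(@lebesgue_measure R \x @lebesgue_measure R)]_p
    (@lebesgue_measure R \o xsection A) p)%E; first by [].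
  by apply: eq_integral => p _; exact: (slice_length p r0 mA lA uA).
rewrite fubini_tonelli1; last 2 first.
- exact/measurable_EFinP.
- by move=> p; rewrite lee_fin mulr_ge0 // sqrtr_ge0.
transitivity (\int[@lebesgue_measure R]_x (pi * Num.max (r ^+ 2 - x ^+ 2) 0)%:E)%E.
  by apply: eq_integral => x _; rewrite /fubini_F /h /= integral_semicircle.
transitivity (\int[@lebesgue_measure R]_(x in `[(- r)%R, r]) (pi * (r ^+ 2 - x ^+ 2))%:E)%E.
  rewrite [RHS]integral_mkcond; apply: eq_integral => x _; rewrite patchE.
  have E : (x \in `[(- r), r]) = (0 <= r ^+ 2 - x ^+ 2).
    rewrite in_itv /= -ler_norml subr_ge0 -(real_normK (num_real x)).
    by rewrite ler_pXn2r ?nnegrE.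
  rewrite mem_setE E; by case: leP => h0; rewrite ?mulr0.
have dG (x : R) : is_derive x (1 : R) (fun x => pi * (r ^+ 2 * x - x ^+ 3 / 3))
    (pi * (r ^+ 2 - x ^+ 2)).
  by apply: is_derive_eq; rewrite /GRing.scale /=; field.
have cG : continuous (fun x : R => pi * (r ^+ 2 - x ^+ 2)).
  move=> x; apply: cvgM; first exact: cvg_cst.
  by apply: cvgB; [exact: cvg_cst|exact: exprn_continuous].
rewrite (FTC2_continuous _ dG cG); last by lra.
by congr (_ %:E); field.
Qed.

(** * Integrals of radial functions *)

(** A function of intervals, written as Phi s' - Phi s, which is squeezed between
    multiples of V s' - V s by the extreme values of h has the density h with
    respect to V. *)
Lemma is_derive_interval_function (R : realType) (Phi V h : R -> R) (a t v : R) : a < t ->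
  (forall s s' e, a <= s -> s <= s' -> V s <= V s' /\
     ((forall r, s <= r <= s' -> `|h r - h t| <= e) ->
      `|Phi s' - Phi s - h t * (V s' - V s)| <= e * (V s' - V s))) ->
  {for t, continuous h} -> is_derive t (1 : R) V v -> is_derive t (1 : R) Phi (h t * v).
Proof.
move=> at_ HPhi ch dV.
suff cPhi : k^-1 * (Phi (k + t) - Phi t) @[k --> 0^'] --> h t * v.
  have E : (fun k => k^-1 *: ((Phi \o shift t) (k *: 1) - Phi t)) =
      (fun k => k^-1 * (Phi (k + t) - Phi t)).
    by apply/funext => k; rewrite /= [_%:A]mulr1.
  apply: DeriveDef; first by rewrite /derivable E; apply/cvg_ex; exists (h t * v).
  by rewrite /derive E; exact/cvg_lim.
have cV : k^-1 * (V (k + t) - V t) @[k --> 0^'] --> v.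
  case: dV => dV <-; apply: cvg_trans dV.
  rewrite (_ : (fun k => k^-1 * _) = (fun k => k^-1 *: ((V \o shift t) (k *: 1) - V t))) //.
  by apply/funext => k; rewrite /= [_%:A]mulr1.
pose err k := k^-1 * (Phi (k + t) - Phi t - h t * (V (k + t) - V t)).
rewrite [X in X @ _](_ : _ = (fun k => h t * (k^-1 * (V (k + t) - V t)) + err k)); last first.
  by apply/funext => k; rewrite /err; ring.
rewrite -[h t * v]addr0; apply: cvgD; first by apply: cvgM; [exact: cvg_cst|exact: cV].
apply/cvgr0Pnorm_le => eps eps0.
pose e := eps / (`|v| + 1).
have v1 : 0 < `|v| + 1 by rewrite ltr_wpDl.
have e0 : 0 < e by rewrite divr_gt0.
have [d /= d0 dh] : exists2 d, 0 < d & forall r, `|t - r| < d -> `|h r - h t| <= e.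
  have /cvgrPdistC_le /(_ _ e0) [d d0 dh] := ch.
  by exists d.
have QV : \forall k \near 0^', `|k^-1 * (V (k + t) - V t)| <= `|v| + 1.
  have /cvg_norm/cvgr_le := cV; apply; by rewrite ltrDl.
near=> k.
have kd : `|k| < d by near: k; apply: dnbhs0_lt.
have ka : `|k| < t - a by near: k; apply: dnbhs0_lt; rewrite subr_gt0.
have kV : `|k^-1 * (V (k + t) - V t)| <= `|v| + 1 by near: k.
have bound : `|Phi (k + t) - Phi t - h t * (V (k + t) - V t)| <= e * `|V (k + t) - V t|.
  have [k0|k0] := leP 0 k.
    have [|le_V H] := HPhi t (k + t) e (ltW at_); first by rewrite lerDr.
    rewrite (ger0_norm (_ : 0 <= V (k + t) - V t)) ?subr_ge0 //; apply: H => r /andP[h1 h2].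
    apply: dh; rewrite ler0_norm; last by rewrite subr_le0.
    by move: kd; rewrite ger0_norm //; lra.
  have [||le_V H] := HPhi (k + t) t e.
  - by move: ka; rewrite ltr0_norm //; lra.
  - by lra.
  rewrite (ler0_norm (_ : V (k + t) - V t <= 0)) ?subr_le0 // opprB.
  rewrite -normrN (_ : - (Phi (k + t) - Phi t - h t * (V (k + t) - V t)) =
    Phi t - Phi (k + t) - h t * (V t - V (k + t))); last by ring.
  apply: H => r /andP[h1 h2].
  apply: dh; rewrite ger0_norm; last by rewrite subr_ge0.
  by move: kd; rewrite ltr0_norm //; lra.
rewrite /err normrM (le_trans (ler_wpM2l (normr_ge0 _) bound)) //.
rewrite mulrCA -normrM (le_trans (ler_wpM2l (ltW e0) kV)) //.
by rewrite /e divfK // gt_eqF.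
Unshelve. all: by end_near. Qed.

Section radial_integral.
Context (R : realType).
Local Notation mu := (@lebesgue_measure R).
Local Notation vol := ((mu \x mu) \x mu)%E.

Lemma measurable_radius : measurable_fun setT (@radius R : T3 R -> measurableTypeR R).
Proof.
apply: (measurableT_comp (f := @Num.sqrt R : measurableTypeR R -> measurableTypeR R)
  (g := fun x : T3 R => x.1.1 ^+ 2 + x.1.2 ^+ 2 + x.2 ^+ 2)).
  by apply: continuous_measurable_fun; exact: sqrt_continuous.
apply: measurable_funD; first apply: measurable_funD; apply: measurable_funX.
- exact: (measurableT_comp measurable_fst measurable_fst).
- exact: (measurableT_comp measurable_snd measurable_fst).
- exact: measurable_snd.
Qed.

Lemma measurable_radius_preimage (A : set (measurableTypeR R)) : measurable A ->
  measurable (@radius R @^-1` A : set (T3 R)).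
Proof. by move=> mA; rewrite -[X in measurable X]setTI; exact: measurable_radius. Qed.

(** Half-open shells are adjacent without overlapping, which makes the integral
    over them additive in the radii. *)
Definition half_open_shell (s t : R) : set (T3 R) := [set x | s < radius x <= t].

Lemma measurable_half_open_shell (s t : R) : measurable (half_open_shell s t).
Proof.
rewrite (_ : half_open_shell s t = @radius R @^-1` `]s, t]).
  by apply: measurable_radius_preimage; exact: measurable_itv.
by apply/seteqP; split => x; rewrite /half_open_shell /= in_itv.
Qed.

Let V (r : R) : R := 4 / 3 * pi * r ^+ 3.

Let closed_ball_set (r : R) : set (T3 R) := @radius R @^-1` `]-oo, r].

Let mball (r : R) : measurable (closed_ball_set r).
Proof. by apply: measurable_radius_preimage; exact: measurable_itv. Qed.

Let vB (r : R) : 0 <= r -> vol (closed_ball_set r) = (V r)%:E.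
Proof.
move=> r0; apply: volume_ball => //.
by move=> x xr; rewrite /closed_ball_set /= in_itv /= ltW.
Qed.

Lemma volume_half_open_shell (s t : R) : 0 <= s -> s <= t ->
  vol (half_open_shell s t) = (V t - V s)%:E.
Proof.
move=> s0 st; have t0 : 0 <= t by exact: le_trans st.
have E : closed_ball_set t = closed_ball_set s `|` half_open_shell s t.
  apply/seteqP; split => x; rewrite /closed_ball_set /half_open_shell /= !in_itv /=.
    by move=> xt; have [xs|xs] := leP (radius x) s; [left|right; rewrite xt].
  by move=> [h|/andP[_ //]]; exact: le_trans h st.
have : vol (closed_ball_set t) = (vol (closed_ball_set s) + vol (half_open_shell s t))%E.
  rewrite E; apply: measureU; [exact: mball|exact: measurable_half_open_shell|].
  apply/seteqP; split => x //; rewrite /closed_ball_set /half_open_shell /= in_itv /=.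
  by move=> [h1 /andP[h2 _]]; have := lt_le_trans h2 h1; rewrite ltxx.
rewrite !vB // EFinB => ->.
by rewrite addeAC subee // add0e.
Qed.

(** The open and the closed ball have the same volume. *)
Lemma volume_sphere (r : R) : 0 <= r -> vol (sphere r) = 0.
Proof.
move=> r0.
have mo : measurable (@radius R @^-1` `]-oo, r[ : set (T3 R)).
  by apply: measurable_radius_preimage; exact: measurable_itv.
have ms : measurable (sphere r : set (T3 R)).
  rewrite (_ : sphere r = @radius R @^-1` [set r]) //.
  by apply: measurable_radius_preimage; exact: measurable_set1.
have vO : vol (@radius R @^-1` `]-oo, r[) = (V r)%:E.
  apply: volume_ball => //.
  by move=> x; rewrite /= in_itv => /ltW.
have E : closed_ball_set r = (@radius R @^-1` `]-oo, r[) `|` sphere r.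
  apply/seteqP; split => x; rewrite /closed_ball_set /sphere /= !in_itv /= le_eqVlt.
    by move=> /predU1P[|]; [right|left].
  by move=> [->|->]; rewrite ?eqxx ?orbT.
have : vol (closed_ball_set r) = (vol (@radius R @^-1` `]-oo, r[) + vol (sphere r))%E.
  rewrite E; apply: measureU => //.
  apply/seteqP; split => x //; rewrite /sphere /= in_itv /= => -[+ h].
  by rewrite h ltxx.
rewrite vB // vO => Er.
have : ((V r)%:E + vol (sphere r) - (V r)%:E)%E = 0%E by rewrite -Er subee.
by rewrite addeAC subee // add0e.
Qed.

Lemma volume_half_open_shell_lty (s t : R) : 0 <= s -> s <= t ->
  (vol (half_open_shell s t) < +oo)%E.
Proof. by move=> s0 st; rewrite volume_half_open_shell // ltry. Qed.

Section integrand.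
Variable h : R -> R.
Hypothesis ch : forall r : R, 0 < r -> {for r, continuous h}.

Lemma within_continuous_pos (s t : R) : 0 < s -> {within `[s, t], continuous h}.
Proof.
move=> s0; apply/continuous_in_subspaceT => r; rewrite inE /= in_itv /= => /andP[sr _].
by apply: ch; exact: lt_le_trans sr.
Qed.

Lemma integrable_radial (s t : R) : 0 < s ->
  vol.-integrable (half_open_shell s t) (EFin \o (h \o @radius R)).
Proof.
move=> s0.
have [st|ts] := leP s t; last first.
  rewrite (_ : half_open_shell s t = set0); first exact: integrable_set0.
  apply/seteqP; split => // x /andP[h1 h2].
  by have := lt_le_trans h1 h2; rewrite ltNge (ltW ts).
apply: measurable_bounded_integrable.
- exact: measurable_half_open_shell.
- exact: volume_half_open_shell_lty (ltW s0) st.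
- apply: (@measurable_comp _ _ _ _ _ _ `[s, t]%classic).
  + exact: measurable_itv.
  + by move=> _ [x /andP[h1 h2] <-]; rewrite /= in_itv /= h2 (ltW h1).
  + apply: subspace_continuous_measurable_fun; first exact: measurable_itv.
    exact: within_continuous_pos.
  + apply: measurable_funTS; exact: measurable_radius.
- have [M [Mr HM]] : bounded_set (h @` `[s, t]).
    apply: compact_bounded; apply: continuous_compact; last exact: segment_compact.
    exact: within_continuous_pos.
  exists M; split => // N MN x /andP[h1 h2] /=; apply: HM MN _ _.
  by exists (radius x) => //; rewrite /= in_itv /= h2 (ltW h1).
Qed.

Let Phi (s t : R) : R := \int[vol]_(x in half_open_shell s t) h (radius x).

Lemma Rintegral_half_open_shell_split (a s t : R) : 0 < a -> a <= s -> s <= t ->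
  Phi a t = Phi a s + Phi s t.
Proof.
move=> a0 as_ st; have E : half_open_shell a t = half_open_shell a s `|` half_open_shell s t.
  apply/seteqP; split => x; rewrite /half_open_shell /=.
    by move=> /andP[h1 h2]; have [xs|xs] := leP (radius x) s; [left; rewrite h1|right].
  move=> [/andP[h1 h2]|/andP[h1 h2]]; apply/andP; split => //.
    exact: le_trans h2 st.
  exact: le_lt_trans h1.
rewrite /Phi E; apply: Rintegral_setU.
- exact: measurable_half_open_shell.
- exact: measurable_half_open_shell.
- by rewrite -E; exact: integrable_radial.
- apply/disj_setPS => x; rewrite /half_open_shell /= => -[/andP[_ h1] /andP[h2 _]].
  by have := lt_le_trans h2 h1; rewrite ltxx.
Qed.

Lemma Rintegral_half_open_shell_approx (s t c e : R) : 0 < s -> s <= t ->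
  (forall r, s <= r <= t -> `|h r - c| <= e) ->
  `|Phi s t - c * (V t - V s)| <= e * (V t - V s).
Proof.
move=> s0 st hc.
have mS := measurable_half_open_shell s t.
have vS := volume_half_open_shell (ltW s0) st.
have ic (k : R) : vol.-integrable (half_open_shell s t) (EFin \o cst k).
  apply: measurable_bounded_integrable => //; 
    first exact: volume_half_open_shell_lty (ltW s0) st.
  by exists `|k|; split => // N kN x _; exact: ltW.
have Ic (k : R) : \int[vol]_(x in half_open_shell s t) k = k * (V t - V s).
  transitivity (k * fine (vol (half_open_shell s t))); first exact: Rintegral_cst.
  by rewrite vS.
have hx x : half_open_shell s t x -> c - e <= h (radius x) <= c + e.
  by move=> /andP[h1 h2]; rewrite -ler_distl; apply: hc; rewrite h2 (ltW h1).
have ih := integrable_radial t s0.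
have lo : (c - e) * (V t - V s) <= Phi s t.
  rewrite -Ic; apply: le_Rintegral => //; first exact: ic.
  by move=> x /hx /andP[].
have up : Phi s t <= (c + e) * (V t - V s).
  rewrite -Ic; apply: le_Rintegral => //; first exact: ic.
  by move=> x /hx /andP[].
by rewrite ler_distl; move: lo up; rewrite mulrBl mulrDl => -> ->.
Qed.

Lemma is_derive_Rintegral_half_open_shell (a t : R) : 0 < a -> a < t ->
  is_derive t (1 : R) (Phi a) (h t * (4 * pi * t ^+ 2)).
Proof.
move=> a0 at_; have t0 : 0 < t by exact: lt_trans at_.
apply: (@is_derive_interval_function _ _ V h a) => //; last 2 first.
- exact: ch.
- by apply: is_derive_eq; rewrite /GRing.scale /=; field.
move=> s s' e as_ ss'.
have s0 : 0 < s by exact: lt_le_trans as_.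
split.
  rewrite /V ler_wpM2l ?mulr_ge0 ?pi_ge0 // ler_pXn2r ?nnegrE ?(ltW s0) //.
  exact: le_trans (ltW s0) ss'.
move=> /(Rintegral_half_open_shell_approx s0 ss').
by rewrite (Rintegral_half_open_shell_split a0 as_ ss') (addrC (Phi a s)) addrK.
Qed.

(** The integral over the half-open shell from a / 2 to t and the primitive F
    have the same derivative on a neighbourhood of the interval from a to b.
    Starting at a / 2 avoids one-sided derivatives at a. *)
Lemma Rintegral_shell (a b : R) (F : R -> R) : 0 < a -> a < b ->
  (forall r : R, 0 < r -> is_derive r (1 : R) F (4 * pi * r ^+ 2 * h r)) ->
  \int[vol]_(x in shell a b) h (radius x) = F b - F a.
Proof.
move=> a0 ab dF.
have b0 : 0 < b by exact: lt_trans ab.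
transitivity (Phi a b).
  have mS : measurable (shell a b : set (T3 R)).
    rewrite (_ : shell a b = @radius R @^-1` `]a, b[).
      by apply: measurable_radius_preimage; exact: measurable_itv.
    by apply/seteqP; split => x; rewrite /shell /= in_itv.
  have ms : measurable (sphere b : set (T3 R)).
    rewrite (_ : sphere b = @radius R @^-1` [set b]) //.
    by apply: measurable_radius_preimage; exact: measurable_set1.
  rewrite /Phi /Rintegral; congr fine.
  have -> : shell a b = half_open_shell a b `\` sphere b.
    apply/seteqP; split => x; rewrite /shell /half_open_shell /sphere /=.
      by move=> /andP[h1 h2]; rewrite h1 (ltW h2); split => // /eqP; rewrite lt_eqF.
    by move=> [/andP[h1 h2] h3]; rewrite h1 lt_neqAle h2 andbT /=; exact/eqP.
  apply/esym; apply: negligible_integral => //.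
  - exact: measurable_half_open_shell.
  - exact: integrable_radial.
  - by apply: volume_sphere; exact: ltW.
pose D r := Phi (a / 2) r - F r.
have a20 : 0 < a / 2 by rewrite divr_gt0.
have a2a : a / 2 < a by lra.
have dD r : a / 2 < r -> is_derive r (1 : R) D 0.
  move=> ar; have r0 : 0 < r by exact: lt_trans ar.
  have d1 := is_derive_Rintegral_half_open_shell a20 ar.
  have := is_deriveB d1 (dF _ r0); congr (is_derive _ _ _ _).
  ring.
have [||c _] := @MVT _ D (fun=> 0) a b ab.
- by move=> r; rewrite in_itv /= => /andP[ar _]; apply: dD; exact: lt_trans ar.
- apply: derivable_within_continuous => r; rewrite in_itv /= => /andP[ar _].
  by case: (dD r (lt_le_trans a2a ar)).
rewrite mul0r /D (Rintegral_half_open_shell_split a20 (ltW a2a) (ltW ab)).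
by move: (Phi _ _) (Phi _ _) => *; lra.
Qed.

End integrand.
End radial_integral.

(** * The costs as quadratic forms *)

Lemma sqnorm_sphere_cst (R : realType) (r c : R) :
  sqnorm_sphere r (fun=> c) = 4 * pi * r ^+ 2 * c ^+ 2.
Proof.
rewrite /sqnorm_sphere /sphere_integral.
have dG (t : R) : is_derive t (1 : R) (fun t => - (c ^+ 2 * r ^+ 2 * cos t))
    (c ^+ 2 * (r ^+ 2 * sin t)).
  by apply: is_derive_eq; rewrite /GRing.scale /=; ring.
have cG : continuous (fun t : R => c ^+ 2 * (r ^+ 2 * sin t)).
  move=> t; apply: cvgM; first exact: cvg_cst.
  by apply: cvgM; [exact: cvg_cst|exact: continuous_sin].
have E : \int[@lebesgue_measure R]_(t in `[0, pi]) (c ^+ 2 * (r ^+ 2 * sin t)) =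
    2 * c ^+ 2 * r ^+ 2.
  rewrite /Rintegral (FTC2_continuous _ dG cG) ?pi_ge0 //= cospi cos0; ring.
rewrite (_ : (fun phi => _) = (fun=> 2 * c ^+ 2 * r ^+ 2)); last by apply/funext => phi.
rewrite Rintegral_cst; last exact: measurable_itv.
rewrite /= lebesgue_measure_itv /= lte_fin mulr_gt0 ?pi_gt0 //= oppr0 addr0; ring.
Qed.

(** A primitive of 4 pi r^2 (a + b r^2 + c / r)^2 = 4 pi (a r + b r^3 + c)^2. *)
Definition profile_sqr_primitive (R : realType) (a b c r : R) : R :=
  4 * pi * (a ^+ 2 * r ^+ 3 / 3 + b ^+ 2 * r ^+ 7 / 7 + c ^+ 2 * r
            + 2 * a * b * r ^+ 5 / 5 + a * c * r ^+ 2 + b * c * r ^+ 4 / 2).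

Lemma sqnorm_shell_profile (R : realType) (r1 r2 a b c : R) (f : pt R -> R) :
  0 < r1 -> r1 < r2 ->
  (forall x, shell r1 r2 x -> f x = profile a b c (radius x)) ->
  sqnorm_shell r1 r2 f = profile_sqr_primitive a b c r2 - profile_sqr_primitive a b c r1.
Proof.
move=> r1_gt0 r12 fE; rewrite /sqnorm_shell /volume.
transitivity (\int[((@lebesgue_measure R \x @lebesgue_measure R)
    \x @lebesgue_measure R)%E]_(x in shell r1 r2) profile a b c (radius x) ^+ 2).
  by apply: eq_Rintegral => x; rewrite inE => /fE ->.
apply: (@Rintegral_shell _ (fun r => profile a b c r ^+ 2)) => //.
- move=> r r0; apply: (@continuous_comp _ _ _ (profile a b c) (fun y => y ^+ 2)).
    by apply/differentiable_continuous/derivable1_diffP; case: (is_derive_profile a b c r0).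
  exact: exprn_continuous.
- move=> r r0; rewrite /profile_sqr_primitive /profile.
  by apply: is_derive_eq; rewrite /GRing.scale /=; field; exact: lt0r_neq0.
Qed.

Lemma sqnorm_shell_cst (R : realType) (r1 r2 c : R) : 0 < r1 -> r1 < r2 ->
  sqnorm_shell r1 r2 (fun=> c) = 4 / 3 * pi * (r2 ^+ 3 - r1 ^+ 3) * c ^+ 2.
Proof.
move=> r1_gt0 r12; rewrite (@sqnorm_shell_profile _ r1 r2 c 0 0) //.
  by rewrite /profile_sqr_primitive; field.
by move=> x _; rewrite /profile !mul0r !addr0.
Qed.

Lemma sqnorm_shell_ge0 (R : realType) (r1 r2 : R) (f : pt R -> R) :
  0 <= sqnorm_shell r1 r2 f.
Proof. by apply: Rintegral_ge0 => x _; exact: sqr_ge0. Qed.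

(** Here x, y, z stand for the scaled source g r1^2, the scaled flux q r2^2 / r1
    and the gap b - zd. *)
Definition Gform (R : realType) (G : coefs R) (x y z : R) : R :=
  G1 G * x ^+ 2 + G2 G * y ^+ 2 + G3 G * z ^+ 2
  + G4 G * x * y + G5 G * x * z + G6 G * y * z.

(** Since 1 / (k^-1 r1) = k / r1 also for k = 0, the convention 0^-1 = 0 makes
    [Grobin r1 r2 k^-1] the right coefficients for every k >= 0, the Dirichlet
    case included. *)
Lemma Gform_Grobin (R : realType) (r1 r2 k g q d : R) : r1 != 0 -> r2 != 0 ->
  let B := - g / 6 in
  let C := r2 ^+ 2 * (2 * B * r2 + q) in
  let A := d + k * dprofile B C r1 - profile 0 B C r1 in
  profile_sqr_primitive A B C r2 - profile_sqr_primitive A B C r1 =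
  4 * pi * r1 ^+ 3 *
  Gform (Grobin r1 r2 k^-1) (g * r1 ^+ 2) (q * (r2 ^+ 2 / r1)) d.
Proof.
move=> r1n0 r2n0 /=; rewrite /profile_sqr_primitive /Gform /dprofile /profile /=.
have -> : 1 / (k^-1 * r1) = k / r1 by rewrite div1r invfM invrK.
by move: (pi) => p; field; rewrite r1n0.
Qed.

Lemma Gdirichlet_Grobin (R : realType) (r1 r2 : R) :
  Gdirichlet r1 r2 = Grobin r1 r2 0.
Proof.
rewrite /Gdirichlet /Grobin mul0r invr0.
by congr Coefs; ring.
Qed.

(** * Minimizers of quadratic costs *)

(** The scale s turns the control c into the variable c s of the quadratic form. *)
Lemma minimizer_quadratic (R : realType) (J : R -> R) (K A B E s : R) :
  0 < K -> 0 < A -> s != 0 ->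
  (forall c, J c = K * (A * (c * s) ^+ 2 + B * (c * s) + E)) ->
  forall c0 v, c0 = - (B / (2 * A)) / s -> v = K * (E - B ^+ 2 / (4 * A)) ->
  is_the_minimizer J c0 /\ J c0 = v.
Proof.
move=> K0 A0 s0 JE c0 v c0E ->; have An0 := lt0r_neq0 A0.
have J0 : J c0 = K * (E - B ^+ 2 / (4 * A)).
  by rewrite JE c0E; field; rewrite ?s0 ?An0.
have JB c : J c = J c0 + K * A * s ^+ 2 * (c - c0) ^+ 2.
  by rewrite J0 JE c0E; field; rewrite ?s0 ?An0.
have KAs : 0 < K * A * s ^+ 2 by rewrite (pmulr_rgt0 _ (mulr_gt0 K0 A0)) exprn_even_gt0.
split => //; split.
- by move=> c; rewrite (JB c) lerDl mulr_ge0 ?sqr_ge0 // ltW.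
- move=> c /(_ c0); rewrite (JB c) gerDl pmulr_rle0 // => h.
  apply/eqP; rewrite -subr_eq0 -sqrf_eq0 eq_le h sqr_ge0 //.
Qed.

(** With D = 4 A C - P^2, the excess over the minimum is
    K (A (dx + P dy / (2 A))^2 + D dy^2 / (4 A)). *)
Lemma minimizer_quadratic2 (R : realType) (J : R * R -> R) (K A C P S T E s t : R) :
  0 < K -> 0 < A -> 0 < 4 * A * C - P ^+ 2 -> s != 0 -> t != 0 ->
  (forall c, J c = K * (A * (c.1 * s) ^+ 2 + C * (c.2 * t) ^+ 2 + P * (c.1 * s) * (c.2 * t)
                        + S * (c.1 * s) + T * (c.2 * t) + E)) ->
  forall c0 w,
  c0.1 = (P * T - 2 * S * C) / (4 * A * C - P ^+ 2) / s ->
  c0.2 = (P * S - 2 * T * A) / (4 * A * C - P ^+ 2) / t ->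
  w = K * (E - (A * T ^+ 2 + C * S ^+ 2 - P * S * T) / (4 * A * C - P ^+ 2)) ->
  is_the_minimizer J c0 /\ J c0 = w.
Proof.
move=> K0 A0 D0 s0 t0 JE c0 w c01 c02 ->; have An0 := lt0r_neq0 A0; have Dn0 := lt0r_neq0 D0.
have J0 : J c0 = K * (E - (A * T ^+ 2 + C * S ^+ 2 - P * S * T) / (4 * A * C - P ^+ 2)).
  by rewrite JE c01 c02; field; rewrite ?s0 ?t0 ?Dn0 ?An0.
pose u (c : R * R) := (c.1 - c0.1) * s + P / (2 * A) * ((c.2 - c0.2) * t).
pose v (c : R * R) := (c.2 - c0.2) * t.
have JB c : J c = J c0 + K * (A * u c ^+ 2 + (4 * A * C - P ^+ 2) / (4 * A) * v c ^+ 2).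
  by rewrite J0 JE /u /v c01 c02; field; rewrite ?s0 ?t0 ?Dn0 ?An0.
have D4 : 0 < (4 * A * C - P ^+ 2) / (4 * A) by rewrite divr_gt0 // mulr_gt0.
have ge0 c : 0 <= A * u c ^+ 2 + (4 * A * C - P ^+ 2) / (4 * A) * v c ^+ 2.
  by rewrite addr_ge0 // mulr_ge0 ?sqr_ge0 // ltW.
split => //; split.
- by move=> c; rewrite (JB c) lerDl mulr_ge0 // ltW.
- move=> c /(_ c0); rewrite (JB c) gerDl pmulr_rle0 // => h.
  have : A * u c ^+ 2 + (4 * A * C - P ^+ 2) / (4 * A) * v c ^+ 2 == 0 by rewrite eq_le h ge0.
  rewrite (paddr_eq0 (mulr_ge0 (ltW A0) (sqr_ge0 _)) (mulr_ge0 (ltW D4) (sqr_ge0 _))).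
  rewrite (mulf_eq0 A) (gt_eqF A0) (mulf_eq0 (_ / _)) (gt_eqF D4) !sqrf_eq0 /=.
  move=> /andP[/eqP u0 /eqP v0].
  move: u0; rewrite /u -/(v c) v0 mulr0 addr0 => /eqP.
  move: v0 => /eqP; rewrite /v !mulf_eq0 (negbTE s0) (negbTE t0) !orbF !subr_eq0.
  by move=> /eqP e2 /eqP e1; rewrite [c]surjective_pairing e1 e2 -surjective_pairing.
Qed.

(** S is any family of states that agree on the closed shell with the radial
    solutions of parameter k, so that the results apply to the Dirichlet states
    and to the Robin states. *)
Section optimality.
Context (R : realType) (r1 r2 k zd : R) (S : R -> R -> R -> pt R -> R).
Hypotheses (r1_gt0 : 0 < r1) (r12 : r1 < r2).
Hypothesis SE : forall g q b x, closed_shell r1 r2 x ->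
  S g q b x = mixed_profile r1 r2 k g q b (radius x).
Let G := Grobin r1 r2 k^-1.

Let r1n0 : r1 != 0. Proof. exact: lt0r_neq0. Qed.
Let r2_gt0 : 0 < r2. Proof. exact: lt_trans r12. Qed.
Let r2n0 : r2 != 0. Proof. exact: lt0r_neq0. Qed.

Lemma sqnorm_state (g q b : R) :
  sqnorm_shell r1 r2 (fun x => S g q b x - zd) =
  4 * pi * r1 ^+ 3 * Gform G (g * r1 ^+ 2) (q * (r2 ^+ 2 / r1)) (b - zd).
Proof.
rewrite -Gform_Grobin //.
apply: sqnorm_shell_profile => // x xS.
rewrite SE; last by case/andP: xS => h1 h2; rewrite /closed_shell /= !ltW.
by rewrite /mixed_profile /profile; ring.
Qed.

(** The form is the square of a norm for a suitable choice of data. *)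
Lemma Gform_ge0 (x y z : R) : 0 <= Gform G x y z.
Proof.
have := sqnorm_shell_ge0 r1 r2 (fun p => S (x / r1 ^+ 2) (y / (r2 ^+ 2 / r1)) (z + zd) p - zd).
rewrite sqnorm_state addrK !divfK ?mulf_neq0 ?invr_eq0 ?expf_neq0 //.
by rewrite pmulr_rge0 // !mulr_gt0 ?pi_gt0 ?exprn_gt0.
Qed.

Lemma G3_gt0 : 0 < G3 G.
Proof.
rewrite /= mulr_gt0 // addrC subr_gt0 exprn_egt1 //.
by rewrite ltr_pdivlMr // mul1r.
Qed.

Lemma G1_ge0 : 0 <= G1 G.
Proof. by have := Gform_ge0 1 0 0; rewrite /Gform; lra. Qed.

Lemma G2_ge0 : 0 <= G2 G.
Proof. by have := Gform_ge0 0 1 0; rewrite /Gform; lra. Qed.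

(** The nonnegative form is evaluated at (P, - 2 A, 0), where P = G4 and
    A = G1 + m1. *)
Lemma discriminant_gt0 (m1 m2 : R) : 0 < m1 -> 0 < m2 ->
  0 < 4 * (G1 G + m1) * (G2 G + m2) - G4 G ^+ 2.
Proof.
move=> m1_gt0 m2_gt0; set A := G1 G + m1; set P := G4 G.
have A0 : 0 < A by rewrite ltr_wpDl ?G1_ge0.
rewrite -(pmulr_rgt0 _ A0).
have := Gform_ge0 P (- 2 * A) 0.
have -> : Gform G P (- 2 * A) 0 =
    A * (4 * A * (G2 G + m2) - P ^+ 2) - m1 * P ^+ 2 - 4 * m2 * A ^+ 2.
  by rewrite /Gform -/P /A; ring.
have h1 : 0 <= m1 * P ^+ 2 by rewrite mulr_ge0 ?sqr_ge0 // ltW.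
have h2 : 0 < m2 * A ^+ 2 by rewrite mulr_gt0 // exprn_gt0.
lra.
Qed.

Let K_gt0 : 0 < 2 * pi * r1 ^+ 3.
Proof. by rewrite !mulr_gt0 ?pi_gt0 ?exprn_gt0. Qed.

Let weight_g_gt0 (M : R) : 0 < M -> 0 < G3 G * (M / r1 ^+ 4).
Proof. by move=> M0; rewrite mulr_gt0 ?G3_gt0 // divr_gt0 ?exprn_gt0. Qed.

Let weight_q_gt0 (M : R) : 0 < M -> 0 < M / (r1 * r2 ^+ 2).
Proof. by move=> M0; rewrite divr_gt0 // mulr_gt0 ?exprn_gt0. Qed.

Let s1n0 : r1 ^+ 2 != 0. Proof. by rewrite expf_neq0. Qed.
Let s2n0 : r2 ^+ 2 / r1 != 0. Proof. by rewrite mulf_neq0 ?invr_eq0 ?expf_neq0. Qed.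

Let cost_g (M c : R) : M / 2 * sqnorm_shell r1 r2 (fun=> c) =
  2 * pi * r1 ^+ 3 * (G3 G * (M / r1 ^+ 4) * (c * r1 ^+ 2) ^+ 2).
Proof. by rewrite sqnorm_shell_cst // /G /=; field. Qed.

Let cost_q (M c : R) : M / 2 * sqnorm_sphere r2 (fun=> c) =
  2 * pi * r1 ^+ 3 * (M / (r1 * r2 ^+ 2) * (c * (r2 ^+ 2 / r1)) ^+ 2).
Proof. by rewrite sqnorm_sphere_cst; field; rewrite r1n0 r2n0. Qed.

Lemma J1_optimal (M q b : R) : 0 < M ->
  is_the_minimizer (J1 r1 r2 S zd M q b) (g_opt r1 r2 G zd M q b) /\
  J1 r1 r2 S zd M q b (g_opt r1 r2 G zd M q b) = J1_opt r1 r2 G zd M q b.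
Proof.
move=> M0; have A0 : 0 < G1 G + G3 G * (M / r1 ^+ 4) by rewrite ltr_wpDl ?G1_ge0 ?weight_g_gt0.
set A := G1 G + _ in A0.
have JE c : J1 r1 r2 S zd M q b c = 2 * pi * r1 ^+ 3 *
    (A * (c * r1 ^+ 2) ^+ 2 + (G4 G * q * (r2 ^+ 2 / r1) + G5 G * (b - zd)) * (c * r1 ^+ 2) +
     (G2 G * q ^+ 2 * (r2 ^+ 4 / r1 ^+ 2) + G3 G * (b - zd) ^+ 2
      + G6 G * q * (r2 ^+ 2 / r1) * (b - zd))).
  rewrite /J1 sqnorm_state cost_g /Gform /A; move: (G) => G'; field; exact: r1n0.
have An0 := lt0r_neq0 A0.
apply: (minimizer_quadratic K_gt0 A0 s1n0 JE).
- by rewrite /g_opt -/A; field; rewrite An0 r1n0.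
- by rewrite /J1_opt -/A; field; rewrite An0 r1n0.
Qed.

Lemma J2_optimal (M g b : R) : 0 < M ->
  is_the_minimizer (J2 r1 r2 S zd M g b) (q_opt r1 r2 G zd M g b) /\
  J2 r1 r2 S zd M g b (q_opt r1 r2 G zd M g b) = J2_opt r1 r2 G zd M g b.
Proof.
move=> M0; have A0 : 0 < G2 G + M / (r1 * r2 ^+ 2) by rewrite ltr_wpDl ?G2_ge0 ?weight_q_gt0.
set A := G2 G + _ in A0.
have JE c : J2 r1 r2 S zd M g b c = 2 * pi * r1 ^+ 3 *
    (A * (c * (r2 ^+ 2 / r1)) ^+ 2
     + (G4 G * g * r1 ^+ 2 + G6 G * (b - zd)) * (c * (r2 ^+ 2 / r1))
     + (G1 G * g ^+ 2 * r1 ^+ 4 + G3 G * (b - zd) ^+ 2 + G5 G * g * r1 ^+ 2 * (b - zd))).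
  by rewrite /J2 sqnorm_state cost_q /Gform /A; move: (G) => G'; field; rewrite r1n0 r2n0.
have An0 := lt0r_neq0 A0.
apply: (minimizer_quadratic K_gt0 A0 s2n0 JE).
- by rewrite /q_opt -/A; field; rewrite An0 r1n0 r2n0.
- by rewrite /J2_opt -/A; field; rewrite An0.
Qed.

Lemma J3_optimal (M g q : R) : 0 < M ->
  is_the_minimizer (J3 r1 r2 S zd M g q) (b_opt r1 r2 G zd M g q) /\
  J3 r1 r2 S zd M g q (b_opt r1 r2 G zd M g q) = J3_opt r1 r2 G zd M g q.
Proof.
move=> M0; have A0 : 0 < G3 G + M / r1 by rewrite addr_gt0 ?G3_gt0 ?divr_gt0.
set A := G3 G + _ in A0.
have JE c : J3 r1 r2 S zd M g q c = 2 * pi * r1 ^+ 3 *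
    (A * (c * 1) ^+ 2
     + (G5 G * g * r1 ^+ 2 + G6 G * q * (r2 ^+ 2 / r1) - 2 * G3 G * zd) * (c * 1)
     + (G1 G * g ^+ 2 * r1 ^+ 4 + G2 G * q ^+ 2 * (r2 ^+ 4 / r1 ^+ 2)
              + G3 G * zd ^+ 2 + G4 G * g * q * r1 * r2 ^+ 2
              - G5 G * g * r1 ^+ 2 * zd - G6 G * q * (r2 ^+ 2 / r1) * zd)).
  by rewrite /J3 sqnorm_state sqnorm_sphere_cst /Gform /A;
    move: (G) => G'; field; rewrite r1n0.
have An0 := lt0r_neq0 A0.
apply: (minimizer_quadratic K_gt0 A0 (oner_neq0 R) JE).
- by rewrite /b_opt -/A; field; rewrite An0 r1n0.
- by rewrite /J3_opt -/A; field; rewrite An0 r1n0.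
Qed.

Lemma J4_optimal (M4 M5 b : R) : 0 < M4 -> 0 < M5 ->
  is_the_minimizer (J4 r1 r2 S zd M4 M5 b) (gq_opt r1 r2 G zd M4 M5 b) /\
  J4 r1 r2 S zd M4 M5 b (gq_opt r1 r2 G zd M4 M5 b) = J4_opt r1 r2 G zd M4 M5 b.
Proof.
move=> M4_gt0 M5_gt0.
have A0 : 0 < G1 G + G3 G * (M4 / r1 ^+ 4) by rewrite ltr_wpDl ?G1_ge0 ?weight_g_gt0.
have D0 := discriminant_gt0 (weight_g_gt0 M4_gt0) (weight_q_gt0 M5_gt0).
set A := G1 G + _ in A0 D0; set C := G2 G + _ in D0.
have JE c : J4 r1 r2 S zd M4 M5 b c = 2 * pi * r1 ^+ 3 *
    (A * (c.1 * r1 ^+ 2) ^+ 2 + C * (c.2 * (r2 ^+ 2 / r1)) ^+ 2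
     + G4 G * (c.1 * r1 ^+ 2) * (c.2 * (r2 ^+ 2 / r1))
     + G5 G * (b - zd) * (c.1 * r1 ^+ 2) + G6 G * (b - zd) * (c.2 * (r2 ^+ 2 / r1))
     + G3 G * (b - zd) ^+ 2).
  by rewrite /J4 sqnorm_state cost_g cost_q /Gform /A /C;
    move: (G) => G'; field; rewrite r1n0 r2n0.
have Dn0 := lt0r_neq0 D0.
apply: (minimizer_quadratic2 K_gt0 A0 D0 s1n0 s2n0 JE);
  rewrite /gq_opt /J4_opt -/A -/C; move: (A) (C) (G3 G) (G4 G) (G5 G) (G6 G) Dn0
    => {JE D0 A0}A {}C P3 P4 P5 P6 Dn0 /=; field; by rewrite ?Dn0 ?r1n0 ?r2n0.
Qed.

End optimality.

(** * Rates of convergence *)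

Section rate.
Context (R : realType).
Implicit Types (f h : R -> R) (l m c : R).

(** Convergence at infinity with the rate 1 / a, a property which is stable under
    the field operations. *)
Definition tends_inv f l := is_bigO_inv (fun a => f a - l).

Lemma tends_inv_le f l (b : R -> R) c : 0 <= c -> tends_inv b 0 ->
  (\forall a \near +oo, `|f a - l| <= c * `|b a|) -> tends_inv f l.
Proof.
move=> c0 [C C0 bC] fb; exists (c * C + 1).
  by rewrite ltr_wpDl // mulr_ge0 // ltW.
near=> a.
have a0 : 0 < a by near: a; apply: nbhs_pinfty_gt; exact: num_real.
have h1 : `|b a| <= C * (1 / a) by rewrite -[b a]subr0; near: a.
have h2 : `|f a - l| <= c * `|b a| by near: a.
rewrite (le_trans h2) // (le_trans (ler_wpM2l c0 h1)) // mulrA ler_wpM2r //.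
  by rewrite divr_ge0 // ltW.
by rewrite lerDl.
Unshelve. all: by end_near. Qed.

Lemma tends_inv_small f l (e : R) : 0 < e -> tends_inv f l ->
  \forall a \near +oo, `|f a - l| <= e.
Proof.
move=> e0 [C C0 fC]; near=> a.
have aC : C / e < a by near: a; apply: nbhs_pinfty_gt; exact: num_real.
have a0 : 0 < a by rewrite (lt_trans _ aC) // divr_gt0.
have h : `|f a - l| <= C * (1 / a) by near: a.
rewrite (le_trans h) // mul1r ler_pdivrMr // mulrC -ler_pdivrMr // ltW //.
Unshelve. all: by end_near. Qed.

Lemma cvg_tends_inv f l : tends_inv f l -> f a @[a --> +oo] --> l.
Proof.
by move=> fl; apply/cvgrPdistC_le => e e0; exact: tends_inv_small.
Qed.

Lemma tends_inv_near f h l : (forall a, 0 < a -> f a = h a) -> tends_inv h l -> tends_inv f l.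
Proof.
move=> fh [C C0 hC]; exists C => //; near=> a.
have a0 : 0 < a by near: a; apply: nbhs_pinfty_gt; exact: num_real.
by rewrite fh //; near: a.
Unshelve. all: by end_near. Qed.

Lemma tends_inv_cst c : tends_inv (fun=> c) c.
Proof.
exists 1 => //; near=> a.
have a0 : 0 < a by near: a; apply: nbhs_pinfty_gt; exact: num_real.
by rewrite subrr normr0 mul1r divr_ge0 // ltW.
Unshelve. all: by end_near. Qed.

(** The limit 1 / (0 * c), which is 0, keeps the shape of the function, as
    [tends_inv_tac] expects. *)
Lemma tends_inv_eps c : tends_inv (fun a => 1 / (a * c)) (1 / (0 * c)).
Proof.
rewrite mul0r invr0 mulr0; exists (`|c^-1| + 1); first by rewrite ltr_wpDl.
near=> a.
have a0 : 0 < a by near: a; apply: nbhs_pinfty_gt; exact: num_real.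
rewrite subr0 !mul1r invfM normrM mulrC [`|a^-1|]ger0_norm ?invr_ge0 ?(ltW a0) //.
by rewrite ler_wpM2r ?invr_ge0 ?(ltW a0) // lerDl.
Unshelve. all: by end_near. Qed.

Lemma tends_invD f h l m : tends_inv f l -> tends_inv h m ->
  tends_inv (fun a => f a + h a) (l + m).
Proof.
move=> [C C0 fC] [D D0 hD]; exists (C + D); first exact: addr_gt0.
near=> a.
have h1 : `|f a - l| <= C * (1 / a) by near: a.
have h2 : `|h a - m| <= D * (1 / a) by near: a.
rewrite (_ : f a + h a - (l + m) = (f a - l) + (h a - m)); last by ring.
by rewrite (le_trans (ler_normD _ _)) // mulrDl lerD.
Unshelve. all: by end_near. Qed.

Lemma tends_invM f h l m : tends_inv f l -> tends_inv h m ->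
  tends_inv (fun a => f a * h a) (l * m).
Proof.
move=> fl hm; have [C C0 fC] := fl; have [D D0 hD] := hm.
exists (C * (`|m| + 1) + `|l| * D + 1).
  by rewrite ltr_wpDl // addr_ge0 // mulr_ge0 // ?addr_ge0 // ltW.
have hb := tends_inv_small ltr01 hm.
near=> a.
have a0 : 0 < a by near: a; apply: nbhs_pinfty_gt; exact: num_real.
have h1 : `|f a - l| <= C * (1 / a) by near: a.
have h2 : `|h a - m| <= D * (1 / a) by near: a.
have h3 : `|h a| <= `|m| + 1.
  rewrite -[h a](subrK m) (le_trans (ler_normD _ _)) // addrC lerD2l.
  by near: a.
have ai : 0 <= 1 / a by rewrite divr_ge0 // ltW.
rewrite (_ : f a * h a - l * m = (f a - l) * h a + l * (h a - m)); last by ring.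
rewrite (le_trans (ler_normD _ _)) // !normrM.
have h4 : `|f a - l| * `|h a| <= C * (1 / a) * (`|m| + 1) by apply: ler_pM.
have h5 : `|l| * `|h a - m| <= `|l| * (D * (1 / a)) by apply: ler_wpM2l.
rewrite (le_trans (lerD h4 h5)) // -subr_ge0.
by rewrite (_ : _ - _ = 1 / a) //; ring.
Unshelve. all: by end_near. Qed.

Lemma tends_invN f l : tends_inv f l -> tends_inv (fun a => - f a) (- l).
Proof.
move=> fl; rewrite -mulN1r (_ : (fun a => _) = (fun a => -1 * f a)).
  by apply: tends_invM => //; exact: tends_inv_cst.
by apply/funext => a; rewrite mulN1r.
Qed.

Lemma tends_invX f l n : tends_inv f l -> tends_inv (fun a => f a ^+ n) (l ^+ n).
Proof.
move=> fl; elim: n => [|n IH]; first exact: tends_inv_cst.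
rewrite exprS (_ : (fun a => _) = (fun a => f a * f a ^+ n)).
  exact: tends_invM.
by apply/funext => a; rewrite exprS.
Qed.

Lemma tends_invV f l : l != 0 -> tends_inv f l -> tends_inv (fun a => (f a)^-1) l^-1.
Proof.
move=> l0 fl; have l2 : 0 < `|l| / 2 by rewrite divr_gt0 ?normr_gt0.
apply: (@tends_inv_le _ _ (fun a => f a - l) (2 / `|l| ^+ 2)).
- by rewrite divr_ge0 ?sqr_ge0.
- have [C C0 fC] := fl; exists C => //.
  by apply: filterS fC => a; rewrite subr0.
have fb := tends_inv_small l2 fl.
near=> a.
have h : `|f a - l| <= `|l| / 2 by near: a.
have fa : `|l| / 2 <= `|f a|.
  have := ler_normB (f a) (f a - l); rewrite subKr => h'; lra.
have fa0 : f a != 0 by rewrite -normr_gt0 (lt_le_trans l2).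
rewrite (_ : (f a)^-1 - l^-1 = - ((f a - l) / (f a * l))); last by field; rewrite l0 fa0.
rewrite normrN normrM mulrC ler_wpM2r // normfV normrM.
rewrite -[2 / _]invf_div lef_pV2 ?posrE ?mulr_gt0 ?normr_gt0
   ?invr_gt0 ?exprn_gt0 ?normr_gt0 //.
by rewrite expr2 mulrAC ler_wpM2r.
Unshelve. all: by end_near. Qed.

End rate.

(** Proves [tends_inv f l] when l is obtained from f by replacing some subterms
    by limits found in the hypotheses; the denominators that must not vanish are
    left as goals. Matching on the syntax keeps the unifier from unfolding the
    large coefficients. *)
Ltac tends_inv_tac := repeat lazymatch goal with
  | |- tends_inv (fun _ => ?c) _ => exact: tends_inv_cst
  | |- tends_inv (fun a => 1 / (a * _)) _ => exact: tends_inv_eps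
  | |- tends_inv (fun a => - _) _ => apply tends_invN
  | |- tends_inv (fun a => _ + _) _ => apply tends_invD
  | |- tends_inv (fun a => _ * _) _ => apply tends_invM
  | |- tends_inv (fun a => _ ^+ _) _ => apply tends_invX
  | |- tends_inv (fun a => _^-1) _ => apply tends_invV
  | |- tends_inv _ _ => assumption
  end.

Section optimal_rates.
Context (R : realType) (r1 r2 zd : R) (Ga : R -> coefs R) (G : coefs R).
Hypothesis r1n0 : r1 != 0.
Hypotheses (G1c : tends_inv (fun a => G1 (Ga a)) (G1 G))
  (G2c : tends_inv (fun a => G2 (Ga a)) (G2 G))
  (G3c : tends_inv (fun a => G3 (Ga a)) (G3 G))
  (G4c : tends_inv (fun a => G4 (Ga a)) (G4 G))
  (G5c : tends_inv (fun a => G5 (Ga a)) (G5 G))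
  (G6c : tends_inv (fun a => G6 (Ga a)) (G6 G)).

Lemma optimal1_rate (M q b : R) : G1 G + G3 G * (M / r1 ^+ 4) != 0 ->
  tends_inv (fun a => g_opt r1 r2 (Ga a) zd M q b) (g_opt r1 r2 G zd M q b) /\
  tends_inv (fun a => J1_opt r1 r2 (Ga a) zd M q b) (J1_opt r1 r2 G zd M q b).
Proof.
by move=> A0; rewrite /g_opt /J1_opt; split; tends_inv_tac; rewrite !mulf_neq0 ?expf_neq0.
Qed.

Lemma optimal2_rate (M g b : R) : G2 G + M / (r1 * r2 ^+ 2) != 0 ->
  tends_inv (fun a => q_opt r1 r2 (Ga a) zd M g b) (q_opt r1 r2 G zd M g b) /\
  tends_inv (fun a => J2_opt r1 r2 (Ga a) zd M g b) (J2_opt r1 r2 G zd M g b).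
Proof.
by move=> A0; rewrite /q_opt /J2_opt; split; tends_inv_tac; rewrite ?mulf_neq0.
Qed.

Lemma optimal3_rate (M g q : R) : G3 G + M / r1 != 0 ->
  tends_inv (fun a => b_opt r1 r2 (Ga a) zd M g q) (b_opt r1 r2 G zd M g q) /\
  tends_inv (fun a => J3_opt r1 r2 (Ga a) zd M g q) (J3_opt r1 r2 G zd M g q).
Proof.
by move=> A0; rewrite /b_opt /J3_opt; split; tends_inv_tac; rewrite ?mulf_neq0.
Qed.

Lemma optimal4_rate (M4 M5 b : R) :
  4 * (G1 G + G3 G * (M4 / r1 ^+ 4)) * (G2 G + M5 / (r1 * r2 ^+ 2)) - G4 G ^+ 2 != 0 ->
  [/\ tends_inv (fun a => (gq_opt r1 r2 (Ga a) zd M4 M5 b).1) (gq_opt r1 r2 G zd M4 M5 b).1,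
      tends_inv (fun a => (gq_opt r1 r2 (Ga a) zd M4 M5 b).2) (gq_opt r1 r2 G zd M4 M5 b).2 &
      tends_inv (fun a => J4_opt r1 r2 (Ga a) zd M4 M5 b) (J4_opt r1 r2 G zd M4 M5 b)].
Proof. by move=> D0; rewrite /gq_opt /J4_opt /=; split; tends_inv_tac. Qed.

End optimal_rates.

(** The Dirichlet coefficients are the Robin coefficients at alpha = 0, because
    0^-1 = 0; the limits then have the same shape as the functions. *)
Lemma Grobin_tends_inv (R : realType) (r1 r2 : R) :
  let Ga := Grobin r1 r2 in let G := Gdirichlet r1 r2 in
  [/\ tends_inv (fun a => G1 (Ga a)) (G1 G), tends_inv (fun a => G2 (Ga a)) (G2 G)
    & tends_inv (fun a => G3 (Ga a)) (G3 G)] /\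
  [/\ tends_inv (fun a => G4 (Ga a)) (G4 G), tends_inv (fun a => G5 (Ga a)) (G5 G)
    & tends_inv (fun a => G6 (Ga a)) (G6 G)].
Proof.
by rewrite Gdirichlet_Grobin /Grobin /=; do 2! split; tends_inv_tac.
Qed.

Lemma is_bigO_inv_norm (R : realType) (f : R -> R) l :
  tends_inv f l -> is_bigO_inv (fun a => `|f a - l|).
Proof. by move=> [C C0 h]; exists C => //; apply: filterS h => a; rewrite normr_id. Qed.

Unset Implicit Arguments.

Theorem theorem4p5 (R : realType) (r1 r2 zd M1 M2 M3 M4 M5 g q b : R)
    (r1_gt0 : 0 < r1) (r12 : r1 < r2)
    (M1_gt0 : 0 < M1) (M2_gt0 : 0 < M2) (M3_gt0 : 0 < M3)
    (M4_gt0 : 0 < M4) (M5_gt0 : 0 < M5) :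
  let G := Gdirichlet r1 r2 in
  let Ga := Grobin r1 r2 in
  let S := state r1 r2 in
  let Sa := robin_state r1 r2 in
  let gop := g_opt r1 r2 G zd M1 q b in
  let gaop := fun alpha => g_opt r1 r2 (Ga alpha) zd M1 q b in
  let qop := q_opt r1 r2 G zd M2 g b in
  let qaop := fun alpha => q_opt r1 r2 (Ga alpha) zd M2 g b in
  let bop := b_opt r1 r2 G zd M3 g q in
  let baop := fun alpha => b_opt r1 r2 (Ga alpha) zd M3 g q in
  let gqop := gq_opt r1 r2 G zd M4 M5 b in
  let gqaop := fun alpha => gq_opt r1 r2 (Ga alpha) zd M4 M5 b in
  let F1 := J1 r1 r2 S zd M1 q b in
  let F1a := fun alpha => J1 r1 r2 (Sa alpha) zd M1 q b in
  let F2 := J2 r1 r2 S zd M2 g b in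
  let F2a := fun alpha => J2 r1 r2 (Sa alpha) zd M2 g b in
  let F3 := J3 r1 r2 S zd M3 g q in
  let F3a := fun alpha => J3 r1 r2 (Sa alpha) zd M3 g q in
  let F4 := J4 r1 r2 S zd M4 M5 b in
  let F4a := fun alpha => J4 r1 r2 (Sa alpha) zd M4 M5 b in
  [/\ [/\ is_the_minimizer F1 gop,
          F1 gop = J1_opt r1 r2 G zd M1 q b &
          forall alpha, 0 < alpha ->
            is_the_minimizer (F1a alpha) (gaop alpha) /\
            F1a alpha (gaop alpha) = J1_opt r1 r2 (Ga alpha) zd M1 q b],
      [/\ is_the_minimizer F2 qop,
          F2 qop = J2_opt r1 r2 G zd M2 g b &
          forall alpha, 0 < alpha ->
            is_the_minimizer (F2a alpha) (qaop alpha) /\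
            F2a alpha (qaop alpha) = J2_opt r1 r2 (Ga alpha) zd M2 g b],
      [/\ is_the_minimizer F3 bop,
          F3 bop = J3_opt r1 r2 G zd M3 g q &
          forall alpha, 0 < alpha ->
            is_the_minimizer (F3a alpha) (baop alpha) /\
            F3a alpha (baop alpha) = J3_opt r1 r2 (Ga alpha) zd M3 g q],
      [/\ is_the_minimizer F4 gqop,
          F4 gqop = J4_opt r1 r2 G zd M4 M5 b &
          forall alpha, 0 < alpha ->
            is_the_minimizer (F4a alpha) (gqaop alpha) /\
            F4a alpha (gqaop alpha) = J4_opt r1 r2 (Ga alpha) zd M4 M5 b] &
      [/\ [/\ gaop alpha @[alpha --> +oo] --> gop,
              qaop alpha @[alpha --> +oo] --> qop,
              baop alpha @[alpha --> +oo] --> bop &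
              gqaop alpha @[alpha --> +oo] --> gqop],
          [/\ is_bigO_inv (fun alpha => `|gaop alpha - gop|),
              is_bigO_inv (fun alpha => `|qaop alpha - qop|),
              is_bigO_inv (fun alpha => `|baop alpha - bop|),
              is_bigO_inv (fun alpha => `|(gqaop alpha).1 - gqop.1|) &
              is_bigO_inv (fun alpha => `|(gqaop alpha).2 - gqop.2|)],
          [/\ F1a alpha (gaop alpha) @[alpha --> +oo] --> F1 gop,
              F2a alpha (qaop alpha) @[alpha --> +oo] --> F2 qop,
              F3a alpha (baop alpha) @[alpha --> +oo] --> F3 bop &
              F4a alpha (gqaop alpha) @[alpha --> +oo] --> F4 gqop] &
          [/\ is_bigO_inv (fun alpha => `|F1a alpha (gaop alpha) - F1 gop|),
              is_bigO_inv (fun alpha => `|F2a alpha (qaop alpha) - F2 qop|),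
              is_bigO_inv (fun alpha => `|F3a alpha (baop alpha) - F3 bop|) &
              is_bigO_inv (fun alpha => `|F4a alpha (gqaop alpha) - F4 gqop|)]]].
Proof.
move=> G Ga S Sa gop gaop qop qaop bop baop gqop gqaop F1 F1a F2 F2a F3 F3a F4 F4a.
have GE : G = Grobin r1 r2 0^-1 by rewrite invr0 -Gdirichlet_Grobin.
have GaE alpha : Ga alpha = Grobin r1 r2 alpha^-1^-1 by rewrite invrK.
have SE g' q' b' x : closed_shell r1 r2 x ->
    S g' q' b' x = mixed_profile r1 r2 0 g' q' b' (radius x) by exact: stateE.
have SaE alpha : 0 < alpha -> forall g' q' b' x, closed_shell r1 r2 x ->
    Sa alpha g' q' b' x = mixed_profile r1 r2 alpha^-1 g' q' b' (radius x).
  by move=> a0 *; exact: robin_stateE.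
have [min1 val1] : is_the_minimizer F1 gop /\ F1 gop = J1_opt r1 r2 G zd M1 q b.
  by rewrite /gop GE; exact: (J1_optimal zd r1_gt0 r12 SE).
have opt1a alpha : 0 < alpha -> is_the_minimizer (F1a alpha) (gaop alpha) /\
    F1a alpha (gaop alpha) = J1_opt r1 r2 (Ga alpha) zd M1 q b.
  by move=> a0; rewrite /gaop GaE; exact: (J1_optimal zd r1_gt0 r12 (SaE _ a0)).
have [min2 val2] : is_the_minimizer F2 qop /\ F2 qop = J2_opt r1 r2 G zd M2 g b.
  by rewrite /qop GE; exact: (J2_optimal zd r1_gt0 r12 SE).
have opt2a alpha : 0 < alpha -> is_the_minimizer (F2a alpha) (qaop alpha) /\
    F2a alpha (qaop alpha) = J2_opt r1 r2 (Ga alpha) zd M2 g b.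
  by move=> a0; rewrite /qaop GaE; exact: (J2_optimal zd r1_gt0 r12 (SaE _ a0)).
have [min3 val3] : is_the_minimizer F3 bop /\ F3 bop = J3_opt r1 r2 G zd M3 g q.
  by rewrite /bop GE; exact: (J3_optimal zd r1_gt0 r12 SE).
have opt3a alpha : 0 < alpha -> is_the_minimizer (F3a alpha) (baop alpha) /\
    F3a alpha (baop alpha) = J3_opt r1 r2 (Ga alpha) zd M3 g q.
  by move=> a0; rewrite /baop GaE; exact: (J3_optimal zd r1_gt0 r12 (SaE _ a0)).
have [min4 val4] : is_the_minimizer F4 gqop /\ F4 gqop = J4_opt r1 r2 G zd M4 M5 b.
  by rewrite /gqop GE; exact: (J4_optimal zd r1_gt0 r12 SE).
have opt4a alpha : 0 < alpha -> is_the_minimizer (F4a alpha) (gqaop alpha) /\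
    F4a alpha (gqaop alpha) = J4_opt r1 r2 (Ga alpha) zd M4 M5 b.
  by move=> a0; rewrite /gqaop GaE; exact: (J4_optimal zd r1_gt0 r12 (SaE _ a0)).
have r1n0 := lt0r_neq0 r1_gt0.
have r2_gt0 := lt_trans r1_gt0 r12.
have G3G_gt0 : 0 < G3 G by rewrite GE; exact: (G3_gt0 _ r1_gt0 r12).
have sg M : 0 < M -> 0 < G3 G * (M / r1 ^+ 4).
  by move=> M0; rewrite mulr_gt0 // divr_gt0 ?exprn_gt0.
have sq M : 0 < M -> 0 < M / (r1 * r2 ^+ 2).
  by move=> M0; rewrite divr_gt0 // mulr_gt0 ?exprn_gt0.
have A1 : G1 G + G3 G * (M1 / r1 ^+ 4) != 0.
  by rewrite gt_eqF // ltr_wpDl ?sg // GE; exact: (G1_ge0 zd r1_gt0 r12 SE).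
have A2 : G2 G + M2 / (r1 * r2 ^+ 2) != 0.
  by rewrite gt_eqF // ltr_wpDl ?sq // GE; exact: (G2_ge0 zd r1_gt0 r12 SE).
have A3 : G3 G + M3 / r1 != 0 by rewrite gt_eqF // addr_gt0 // divr_gt0.
have D : 4 * (G1 G + G3 G * (M4 / r1 ^+ 4)) * (G2 G + M5 / (r1 * r2 ^+ 2)) - G4 G ^+ 2 != 0.
  rewrite gt_eqF //; move: (sg _ M4_gt0) (sq _ M5_gt0); rewrite GE.
  exact: (discriminant_gt0 zd r1_gt0 r12 SE).
have [[c1 c2 c3] [c4 c5 c6]] := Grobin_tends_inv r1 r2.
have [rg rJ1] := optimal1_rate r2 zd r1n0 c1 c2 c3 c4 c5 c6 q b A1.
have [rq rJ2] := optimal2_rate zd c1 c2 c3 c4 c5 c6 g b A2.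
have [rb rJ3] := optimal3_rate r2 zd c1 c2 c3 c4 c5 c6 g q A3.
have [rg4 rq4 rJ4] := optimal4_rate zd c1 c2 c3 c4 c5 c6 b D.
have {}rJ1 : tends_inv (fun alpha => F1a alpha (gaop alpha)) (F1 gop).
  by rewrite val1; apply: tends_inv_near rJ1 => alpha /opt1a [].
have {}rJ2 : tends_inv (fun alpha => F2a alpha (qaop alpha)) (F2 qop).
  by rewrite val2; apply: tends_inv_near rJ2 => alpha /opt2a [].
have {}rJ3 : tends_inv (fun alpha => F3a alpha (baop alpha)) (F3 bop).
  by rewrite val3; apply: tends_inv_near rJ3 => alpha /opt3a [].
have {}rJ4 : tends_inv (fun alpha => F4a alpha (gqaop alpha)) (F4 gqop).
  by rewrite val4; apply: tends_inv_near rJ4 => alpha /opt4a [].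
split; [by split|by split|by split|by split|split].
- split; [exact: cvg_tends_inv|exact: cvg_tends_inv|exact: cvg_tends_inv|].
  rewrite [X in _ --> X]surjective_pairing (_ : (fun alpha => gqaop alpha) =
    (fun alpha => ((gqaop alpha).1, (gqaop alpha).2))); last first.
    by apply/funext => alpha; rewrite -surjective_pairing.
  exact: (cvg_pair (cvg_tends_inv rg4) (cvg_tends_inv rq4)).
- by split; exact: is_bigO_inv_norm.
- by split; exact: cvg_tends_inv.
- by split; exact: is_bigO_inv_norm.
Qed.
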